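(* Let $X$ be a locally compact, connected, locally connected Hausdorff space. Every solid-set function $\lambda:\mathscr{A}_s^*(X)\to[0,\infty)$ extends uniquely to a compact-finite topological measure on $X$; that is, there is exactly one compact-finite topological measure $\mu$ on $X$ with $\mu(A)=\lambda(A)$ for all $A\in\mathscr{A}_s^*(X)$.
   Context: All spaces are Hausdorff (compact spaces are included among the locally compact ones). $\mathscr{O}(X)$, $\mathscr{C}(X)$, $\mathscr{K}(X)$ denote the open, closed, compact subsets of $X$. A set is bounded if its closure is compact. ''Component'' means connected component. The empty set is regarded as connected. $\bigsqcup$ (or $\sqcup$) denotes a union of disjoint sets. Solid sets: if $X$ is noncompact, $A\subseteq X$ is solid if $A$ is connected and every component of $X\setminus A$ is unbounded; if $X$ is compact, $A$ is solid if $A$ and $X\setminus A$ are connected. $\mathscr{K}_s(X)$ is the family of compact solid sets, $\mathscr{O}_s^*(X)$ the family of bounded open solid sets, and $\mathscr{A}_s^*(X)=\mathscr{K}_s(X)\cup\mathscr{O}_s^*(X)$. A solid-set function on $X$ is a function $\lambda:\mathscr{A}_s^*(X)\to[0,\infty)$ such that: (s1) $\sum_{i=1}^n\lambda(C_i)\le\lambda(C)$ whenever $\bigsqcup_{i=1}^n C_i\subseteq C$ with $C,C_i\in\mathscr{K}_s(X)$; (s2) $\lambda(U)=\sup\{\lambda(K):K\subseteq U,\ K\in\mathscr{K}_s(X)\}$ for $U\in\mathscr{O}_s^*(X)$; (s3) $\lambda(K)=\inf\{\lambda(U):K\subseteq U,\ U\in\mathscr{O}_s^*(X)\}$ for $K\in\mathscr{K}_s(X)$;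 (s4) $\lambda(A)=\sum_{i=1}^n\lambda(A_i)$ whenever $A=\bigsqcup_{i=1}^n A_i$ with $A,A_i\in\mathscr{A}_s^*(X)$. A topological measure on $X$ is a set function $\mu:\mathscr{C}(X)\cup\mathscr{O}(X)\to[0,\infty]$, not identically $\infty$, such that: (TM1) $\mu(A\sqcup B)=\mu(A)+\mu(B)$ whenever $A,B,A\sqcup B\in\mathscr{K}(X)\cup\mathscr{O}(X)$; (TM2) $\mu(U)=\sup\{\mu(K):K\in\mathscr{K}(X),K\subseteq U\}$ for $U\in\mathscr{O}(X)$; (TM3) $\mu(F)=\inf\{\mu(U):U\in\mathscr{O}(X),F\subseteq U\}$ for $F\in\mathscr{C}(X)$. It is compact-finite if $\mu(K)<\infty$ for every compact $K$. *)

(* Defs.v *)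
From HB Require Import structures.
From mathcomp Require Import all_boot all_order all_algebra.
From mathcomp Require Import all_classical all_reals all_analysis.

Set Implicit Arguments.
Unset Strict Implicit.
Unset Printing Implicit Defensive.

Import Order.TTheory GRing.Theory Num.Theory.

Local Open Scope classical_set_scope.
Local Open Scope ring_scope.

Definition locally_connected (X : topologicalType) : Prop :=
  forall (x : X) (U : set X), nbhs x U ->
    exists V : set X, [/\ open V, connected V, V x & V `<=` U].

Section SolidSets.
Context {X : topologicalType}.
Implicit Types A : set X.

(* "Bounded" subset of a topological space: not the metric notion. *)
Definition bounded_subset A : Prop := compact (closure A).

Definition solid A : Prop :=
  [/\ connected A,
      compact [set: X] -> connected (~` A)
    & ~ compact [set: X] -> forall x : X, (~` A) x ->
        ~ bounded_subset (connected_component (~` A) x)].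

Definition compact_solid A : Prop := compact A /\ solid A.

Definition bounded_open_solid A : Prop :=
  [/\ open A, bounded_subset A & solid A].

Definition bounded_solid A : Prop := compact_solid A \/ bounded_open_solid A.

End SolidSets.

(* Set functions are total on [set X]; only their values on the relevant
   family of sets (here [bounded_solid]) are constrained. *)
Record solid_set_function (R : realType) (X : topologicalType)
    (lambda : set X -> R) : Prop := SolidSetFunction {
  solid_fun_ge0 : forall A, bounded_solid A -> 0 <= lambda A;
  solid_fun_superadd : forall (n : nat) (D : 'I_n -> set X) (C : set X),
    compact_solid C -> (forall i, compact_solid (D i)) ->
    trivIset [set: 'I_n] D -> \bigcup_(i in [set: 'I_n]) D i `<=` C ->
    \sum_(i < n) lambda (D i) <= lambda C;
  solid_fun_inner_regular : forall U, bounded_open_solid U ->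
    (lambda U)%:E =
      ereal_sup [set (lambda K)%:E | K in [set K | K `<=` U /\ compact_solid K]];
  solid_fun_outer_regular : forall K, compact_solid K ->
    (lambda K)%:E =
      ereal_inf [set (lambda U)%:E |
                 U in [set U | K `<=` U /\ bounded_open_solid U]];
  solid_fun_additive : forall (n : nat) (B : 'I_n -> set X) (A : set X),
    bounded_solid A -> (forall i, bounded_solid (B i)) ->
    trivIset [set: 'I_n] B -> A = \bigcup_(i in [set: 'I_n]) B i ->
    lambda A = \sum_(i < n) lambda (B i)
}.

Definition closed_or_open (X : topologicalType) (A : set X) : Prop :=
  closed A \/ open A.

Definition compact_or_open (X : topologicalType) (A : set X) : Prop :=
  compact A \/ open A.

Record topological_measure (R : realType) (X : topologicalType)
    (mu : set X -> \bar R) : Prop := TopologicalMeasure {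
  topmeas_ge0 : forall A, closed_or_open A -> (0 <= mu A)%E;
  topmeas_proper : exists2 A, closed_or_open A & mu A <> +oo%E;
  topmeas_additive : forall A B,
    compact_or_open A -> compact_or_open B -> compact_or_open (A `|` B) ->
    A `&` B = set0 -> mu (A `|` B) = (mu A + mu B)%E;
  topmeas_inner_regular : forall U, open U ->
    mu U = ereal_sup [set mu K | K in [set K | compact K /\ K `<=` U]];
  topmeas_outer_regular : forall F, closed F ->
    mu F = ereal_inf [set mu U | U in [set U | open U /\ F `<=` U]]
}.

Definition compact_finite (R : realType) (X : topologicalType)
    (mu : set X -> \bar R) : Prop :=
  forall K, compact K -> (mu K < +oo)%E.

Definition extends_solid (R : realType) (X : topologicalType)
    (lambda : set X -> R) (mu : set X -> \bar R) : Prop :=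
  forall A, bounded_solid A -> mu A = (lambda A)%:E.

(* Main.v *)
Require Import Defs.
From HB Require Import structures.
From mathcomp Require Import all_boot all_order all_algebra.
From mathcomp Require Import finmap.
From mathcomp Require Import all_classical all_reals all_analysis.

(** Additivity dictates how a solid-set function [lam] must extend. Let [P] be a
connected set, compact or bounded open, whose complement has finitely many
components. The bounded ones are the holes of [P]; filling them in gives a solid
set, the hull, and the holes are solid as well, so the measure of [P] can only be
[lam (hull P)] minus the sum of [lam] over the holes. This number is [mu_cell P].

That it is consistent is [mu_cell_fsum]: for disjoint such sets inside a solid set
[S] the values add up to at most [lam S], and to exactly [lam S] if they exhaust
[S]. If every member is solid, this is what the axioms of [lam] say. Otherwise pick
a member [P] that is not solid. The members inside a hole of [P] are controlled by
induction, with that hole in the place of [S]; then [P] and everything in its holes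
is replaced by the hull of [P], and there is one nonsolid member fewer.

Summing over components, one gets a monotone and additive function [mu_nice] on the
nice sets, those with finitely many components and finitely many complementary
components. Compact nice sets form a neighbourhood base of every compact set
([compact_finite_between]; local connectedness enters here). The measure of a compact
set is the infimum of [mu_nice] over its nice compact neighbourhoods, that of an
open set is the supremum over its compact subsets, and that of any other set is the
infimum over the open sets around it. Both regularity axioms are then built in. Two
disjoint compact sets have disjoint nice neighbourhoods, which gives additivity for
them and for two open sets. The remaining case is a compact set [K] in an open set
[W]: the nontrivial inequality is [mu_cpt_le_nice_add], where a nice set
around [K] and another one around the boundary of a larger neighbourhood cut that
neighbourhood into finitely many nice pieces.

Another extension agrees with [mu_cell] by additivity, hence with [mu_nice], and
monotonicity then determines it on compact sets.

In a compact space there is no unbounded set to tell the outside of [P] from its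
holes. There a point [z] is chosen, and the component of the complement that
contains [z] counts as the outside. The predicate [big] stands for unbounded in the
first case and for containing [z] in the second, so that one argument serves both;
the solid sets that contain [z] are recovered from their complements. *)

Set Implicit Arguments.
Unset Strict Implicit.
Unset Printing Implicit Defensive.

Import Order.TTheory GRing.Theory Num.Theory.

Local Open Scope classical_set_scope.
Local Open Scope ring_scope.

(** * Finite sums indexed by sets *)

Lemma finite_set_ind (T : choiceType) (Phi : set T -> Prop) : Phi set0 ->
  (forall a A, finite_set A -> ~ A a -> Phi A -> Phi (a |` A)) ->
  forall A, finite_set A -> Phi A.
Proof.
move=> Phi0 PhiU A /finite_seqP[s ->]; elim: s => [|a s IH]; first by rewrite set_nil.
have -> : [set` a :: s] = a |` [set` s].
  apply/seteqP; split=> b /=; first by rewrite inE => /orP[/eqP|]; [left|right].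
  by move=> [->|bs]; rewrite inE ?eqxx ?bs ?orbT.
have [as_|nas] := boolP (a \in s).
  suff -> : a |` [set` s] = [set` s] by [].
  by apply/seteqP; split=> b; [move=> [->|]|right].
by apply: PhiU => //; exact/negP.
Qed.

Section FiniteSums.
Variable R : realType.

Lemma fsum_le (T : choiceType) (A : set T) (f g : T -> R) : finite_set A ->
  (forall a, A a -> f a <= g a) -> \sum_(a \in A) f a <= \sum_(a \in A) g a.
Proof.
move=> fA fg; rewrite !fsbig_finite// big_seq [leRHS]big_seq.
by apply: ler_sum => a; rewrite in_fset_set// inE => /fg.
Qed.

Lemma fsum_group (T U : choiceType) (A : set T) (B : set U) (r : U -> set T)
    (f : T -> R) : finite_set A -> finite_set B ->
  (forall a, A a -> exists2 b, B b & r b a) ->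
  (forall a b c, A a -> B b -> B c -> r b a -> r c a -> b = c) ->
  \sum_(a \in A) f a = \sum_(b \in B) \sum_(a \in A `&` r b) f a.
Proof.
move=> fA fB ex un; under [RHS]eq_fsbigr do rewrite fsbig_mkcondr.
rewrite exchange_fsbig//; apply: eq_fsbigr => a; rewrite inE => Aa.
have [b Bb rba] := ex _ Aa; rewrite (fsbigD1 b)//= ifT ?inE// fsbig1 ?addr0//.
move=> c [Bc /= cb]; case: ifPn => //; rewrite inE => rca.
by case: cb; exact: un rca rba.
Qed.

Lemma fsum_enum (T : choiceType) (A : set T) : finite_set A ->
  exists n (D : 'I_n -> T), [/\ injective D, range D = A &
    forall f : T -> R, \sum_(a \in A) f a = \sum_(i < n) f (D i)].
Proof.
move=> fA; pose s : seq T := enum_fset (fset_set A).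
have sA a : (a \in s) = (a \in A).
  by rewrite -[LHS]/(a \in fset_set A) in_fset_set.
exists (size s), (tnth (in_tuple s)); split.
- by apply/tuple_uniqP; exact: fset_uniq.
- apply/seteqP; split=> [_ [i _ <-]|a Aa].
    by have := mem_tnth i (in_tuple s); rewrite /= sA inE.
  have /tnthP[i ->] : a \in in_tuple s by rewrite /= sA inE.
  by exists i.
- by move=> f; rewrite fsbig_finite// big_tnth.
Qed.

End FiniteSums.

(** * Connected components *)

Definition components (X : topologicalType) (A : set X) : set (set X) :=
  connected_component A @` A.

Section Components.
Variable X : topologicalType.
Implicit Types A B C D P Q U V : set X.

Lemma component_in A x : A x -> components A (connected_component A x).
Proof. by move=> Ax; exists x. Qed.

Lemma components_neq0 A D : components A D -> D !=set0.
Proof. by case=> x Ax <-; exists x; exact: connected_component_refl. Qed.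

Lemma components_connected A D : components A D -> connected D.
Proof. by case=> x _ <-; exact: component_connected. Qed.

Lemma components_sub A D : components A D -> D `<=` A.
Proof. by case=> x _ <-; exact: connected_component_sub. Qed.

Lemma componentsE A D x : components A D -> D x -> D = connected_component A x.
Proof. by case=> y _ <- /same_connected_component. Qed.

Lemma components_max A D Q : components A D -> connected Q -> Q `<=` A ->
  Q `&` D !=set0 -> Q `<=` D.
Proof.
move=> AD Qc QA [x [Qx Dx]]; rewrite (componentsE AD Dx).
exact: connected_component_max.
Qed.

Lemma components_eq A D E : components A D -> components A E ->
  D `&` E !=set0 -> D = E.
Proof.
by move=> AD AE [x [Dx Ex]]; rewrite (componentsE AD Dx) (componentsE AE Ex).
Qed.

Lemma components_trivIset A : trivIset (components A) id.
Proof. by move=> D E AD AE DE; exact: (components_eq AD AE DE). Qed.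

Lemma components_cover A : \bigcup_(D in components A) D = A.
Proof. exact: connected_component_cover. Qed.

Lemma components_restrict A B D : components A D -> D `<=` B -> B `<=` A ->
  components B D.
Proof.
move=> AD DB BA; have [x Dx] := components_neq0 AD; exists x; first exact: DB.
apply/seteqP; split; last first.
  by apply: connected_component_max => //; exact: components_connected AD.
apply: (components_max AD); first exact: component_connected.
  by apply: subset_trans BA; exact: connected_component_sub.
by exists x; split=> //; exact/connected_component_refl/DB.
Qed.

Lemma components_of_connected A : connected A -> A !=set0 ->
  components A = [set A].
Proof.
move=> Ac [x Ax]; apply/seteqP; split=> [D [y Ay <-]|D ->].
  exact: connected_component_id.
by exists x => //; exact: connected_component_id.
Qed.

Lemma components_set0 : components (@set0 X) = set0.
Proof. by apply/seteqP; split=> // D [x []]. Qed.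

Lemma separated_open U V : open U -> open V -> U `&` V = set0 -> separated U V.
Proof.
move=> oU oV UV0; split; apply/disjoints_subset => x Ux /=.
  move=> Vx; have [y []] := Ux V (open_nbhs_nbhs (conj oV Vx)).
  by move=> Uy Vy; move: (conj Uy Vy : (U `&` V) y); rewrite UV0.
move=> Vx; have [y []] := Vx U (open_nbhs_nbhs (conj oU Ux)).
by move=> Vy Uy; move: (conj Uy Vy : (U `&` V) y); rewrite UV0.
Qed.

Lemma connectedU_closure A B : connected A -> connected B ->
  closure A `&` B !=set0 -> connected (A `|` B).
Proof.
move=> Ac Bc [b [clAb Bb]]; apply/connectedP => E [E0 EU sE].
have AE : A `<=` E false `|` E true by rewrite -EU; exact: subsetUl.
have BE : B `<=` E false `|` E true by rewrite -EU; exact: subsetUr.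
have E01 := separated_disjoint sE.
have sub i : A `<=` E i -> B `<=` E i -> False.
  move=> Ai Bi; have [x Ex] := E0 (~~ i).
  have : E i x.
    have : (E false `|` E true) x by case: (i) Ex => /=; [left|right].
    by rewrite -EU => -[/Ai|/Bi].
  move=> Eix; suff : (E false `&` E true) x by rewrite E01.
  by case: (i) Ex Eix.
have cross i : A `<=` E i -> B `<=` E (~~ i) -> False.
  move=> Ai Bi; have := closureS Ai clAb; have := Bi _ Bb.
  move: sE => [s1 s2]; case: (i) => /= Eb clEb.
    suff : (E false `&` closure (E true)) b by rewrite s2.
    by [].
  suff : (closure (E false) `&` E true) b by rewrite s1.
  by [].
have [Ai|Ai] := connected_subset sE AE Ac;
  have [Bi|Bi] := connected_subset sE BE Bc.
- exact: (sub false).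
- exact: (cross false).
- exact: (cross true).
- exact: (sub true).
Qed.

Lemma connected_star P (F : set (set X)) : P !=set0 -> connected P ->
  (forall D, F D -> connected (P `|` D)) -> connected (P `|` \bigcup_(D in F) D).
Proof.
move=> [x Px] Pc PD.
have -> : P `|` \bigcup_(D in F) D =
    \bigcup_(D in [set D | F D \/ D = P]) (P `|` D).
  apply/seteqP; split=> y.
    move=> [Py|[D FD Dy]]; first by exists P; [right|left].
    by exists D; [left|right].
  move=> [D [FD [Py|Dy]|->]]; first by left.
    by right; exists D.
  by rewrite setUid; left.
apply: bigcup_connected; first by exists x => D _; left.
by move=> D [/PD//|->]; rewrite setUid.
Qed.

Lemma open_bigcup_set (F : set (set X)) : (forall D, F D -> open D) ->
  open (\bigcup_(D in F) D).
Proof. by move=> FD; exact: bigcup_open. Qed.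

Lemma closed_bigcup_set (F : set (set X)) : finite_set F ->
  (forall D, F D -> closed D) -> closed (\bigcup_(D in F) D).
Proof. by move=> Ff FD; exact: closed_bigcup. Qed.

(** A connected subset of [A] lies in a single component, so the members of [F]
determine all the components they meet. *)
Lemma finite_components A (F : set (set X)) : finite_set F ->
  (forall Q, F Q -> connected Q /\ Q `<=` A) ->
  (forall D, components A D -> exists2 Q, F Q & Q `&` D !=set0) ->
  finite_set (components A).
Proof.
move=> Ff FQ FD.
pose g Q := \bigcup_(x in Q) connected_component A x.
apply: (@sub_finite_set _ _ (g @` F)); last exact: finite_image.
move=> D AD; have [Q FQ1 QD] := FD _ AD; exists Q => //.
have [Qc QA] := FQ _ FQ1; have QsD := components_max AD Qc QA QD.
apply/seteqP; split=> y.
  by case=> x /QsD Dx; rewrite -(componentsE AD Dx).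
by case: QD => x [Qx Dx] Dy; exists x => //; rewrite -(componentsE AD Dx).
Qed.

Lemma finite_components_cover A (F : set (set X)) : finite_set F ->
  (forall Q, F Q -> connected Q) -> A = \bigcup_(Q in F) Q ->
  finite_set (components A).
Proof.
move=> Ff FQ AF; apply: (finite_components Ff) => [Q FQ1|D AD].
  by split; [exact: FQ|rewrite AF => x Qx; exists Q].
have [x Dx] := components_neq0 AD; have := components_sub AD Dx.
by rewrite AF => -[Q FQ1 Qx]; exists Q => //; exists x.
Qed.

Lemma finite_componentsU A B : finite_set (components A) ->
  finite_set (components B) -> finite_set (components (A `|` B)).
Proof.
move=> fA fB; apply: (@finite_components_cover _ (components A `|` components B)).
- by rewrite finite_setU.
- by move=> Q [] /components_connected.
- by rewrite bigcup_setU !components_cover.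
Qed.

Lemma finite_components_sub A (F : set (set X)) : finite_set (components A) ->
  F `<=` components A -> finite_set (components (\bigcup_(Q in F) Q)).
Proof.
move=> fA FA; apply: (@finite_components_cover _ F) => //.
  exact: sub_finite_set fA.
by move=> Q /FA /components_connected.
Qed.

End Components.

(** Otherwise the sets whose complement in [K] satisfies [Phi] would form a proper
filter on [K], and local validity of [Phi] rules out a cluster point. This replaces
extracting finite subcovers. *)
Lemma compact_induction (X : topologicalType) (Phi : set X -> Prop) (K : set X) :
  Phi set0 -> (forall A B, A `<=` B -> Phi B -> Phi A) ->
  (forall A B, Phi A -> Phi B -> Phi (A `|` B)) ->
  (forall x, K x -> exists2 U, nbhs x U & Phi U) ->
  compact K -> Phi K.
Proof.
move=> Phi0 PhiS PhiU Phix cK; apply: contrapT => nPhi.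
pose F : set_system X := [set S | Phi (K `\` S)].
have FF : ProperFilter F.
  split; first by rewrite /F /= setD0.
  split; first by rewrite /F /= setDT.
    by move=> P Q FP FQ; rewrite /F /= setDIr; exact: PhiU.
  by move=> P Q PQ; apply: PhiS; exact: setDS.
have [x [Kx clx]] : K `&` cluster F !=set0.
  by apply: cK; rewrite /F /= setDv.
have [U Ux PU] := Phix _ Kx.
have [y [/= nU Uy]] : (~` U) `&` U !=set0.
  apply: clx => //; rewrite /F /= setDE setCK.
  by apply: PhiS PU; exact: subIsetr.
exact: nU.
Qed.

(** * Locally compact, connected, locally connected spaces *)

Section LocallyNice.
Variable X : topologicalType.
Hypothesis X_hausdorff : hausdorff_space X.
Hypothesis X_locally_compact : locally_compact [set: X].
Hypothesis X_connected : connected [set: X].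
Hypothesis X_locally_connected : locally_connected X.
Implicit Types A B C D P Q U V K L : set X.

Lemma components_open A D : open A -> components A D -> open D.
Proof.
move=> oA AD; rewrite openE => y Dy.
have /X_locally_connected[V [oV Vc Vy VA]] : nbhs y A.
  by apply: open_nbhs_nbhs; split=> //; exact: components_sub AD _ Dy.
apply: filterS (open_nbhs_nbhs (conj oV Vy)).
by apply: components_max AD Vc VA _; exists y.
Qed.

Lemma components_closed A D : closed A -> components A D -> closed D.
Proof. by move=> cA [x _ <-]; exact: component_closed. Qed.

Lemma clopen_full A : open A -> closed A -> A !=set0 -> A = setT.
Proof.
by move=> oA cA A0; apply: X_connected => //; exists A => //; rewrite setTI.
Qed.

Lemma compact_is_closed K : compact K -> closed K.
Proof. exact: compact_closed. Qed.

Lemma bounded_sub A B : A `<=` B -> bounded_subset B -> bounded_subset A.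
Proof.
move=> AB bB; apply: subclosed_compact bB _; first exact: closed_closure.
exact: closureS.
Qed.

Lemma compact_bounded K : compact K -> bounded_subset K.
Proof. by move=> cK; rewrite /bounded_subset -(closure_id K).1//; exact: compact_is_closed. Qed.

Lemma closed_bounded_compact A : closed A -> bounded_subset A -> compact A.
Proof. by move=> /closure_id {2}->. Qed.

Lemma boundedU A B : bounded_subset A -> bounded_subset B ->
  bounded_subset (A `|` B).
Proof. by move=> bA bB; rewrite /bounded_subset closureU; exact: compactU. Qed.

Lemma bounded_bigcup (F : set (set X)) : finite_set F ->
  (forall D, F D -> bounded_subset D) -> bounded_subset (\bigcup_(D in F) D).
Proof.
move=> Ff; elim/finite_set_ind: F / Ff => [_|D F _ _ IH bF].
  by rewrite bigcup_set0 /bounded_subset closure0; exact: compact0.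
rewrite bigcup_setU bigcup_set1; apply: boundedU; first by apply: bF; left.
by apply: IH => E FE; apply: bF; right.
Qed.

Lemma nbhs_bounded_open x U : nbhs x U ->
  exists V, [/\ open V, V x, bounded_subset V & closure V `<=` U].
Proof.
move=> Ux; have [C nC [cC clC]] := X_locally_compact (I : [set: X] x).
have nxC : nbhs x C by move: nC; rewrite /globally/= within_interior // interiorT.
have [D nD DU] := compact_regular X_hausdorff cC nxC Ux.
have sub : closure (D° `&` C°) `<=` closure D `&` C.
  move=> y /closureI[Dy Cy]; split; first by apply: closureS Dy; exact: interior_subset.
  by rewrite (closure_id C).1//; apply: closureS Cy; exact: interior_subset.
exists (D° `&` C°); split.
- by apply: openI; exact: open_interior.
- by [].
- apply: (subclosed_compact (@closed_closure _ _) cC).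
  by move=> y /sub[].
- by move=> y /sub[/DU].
Qed.

Lemma compact_bounded_open K U : compact K -> open U -> K `<=` U ->
  exists V, [/\ open V, K `<=` V, bounded_subset V & closure V `<=` U].
Proof.
move=> cK oU KU; apply: (@compact_induction _ (fun A =>
  exists V, [/\ open V, A `<=` V, bounded_subset V & closure V `<=` U])) cK.
- exists set0; split=> //; first exact: open0.
    by apply: compact_bounded; exact: compact0.
  by rewrite closure0.
- by move=> A B AB [V [oV BV bV VU]]; exists V; split=> //; exact: subset_trans BV.
- move=> A B [V [oV AV bV VU]] [W [oW BW bW WU]]; exists (V `|` W); split.
  + exact: openU.
  + exact: setUSS.
  + exact: boundedU.
  + by rewrite closureU subUset.
- move=> x /KU Ux.
  have [V [oV Vx bV VU]] := nbhs_bounded_open (open_nbhs_nbhs (conj oU Ux)).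
  by exists V; [exact: open_nbhs_nbhs|exists V; split].
Qed.

Lemma compact_separated K L : compact K -> closed L -> K `&` L = set0 ->
  exists U V, [/\ open U, open V, K `<=` U, L `<=` V & U `&` V = set0].
Proof.
move=> cK cL KL0.
have [U [oU KU _ UL]] : exists V,
    [/\ open V, K `<=` V, bounded_subset V & closure V `<=` ~` L].
  apply: compact_bounded_open => //; first exact: closed_openC.
  exact/disjoints_subset.
exists U, (~` closure U); split=> //.
- exact/closed_openC/closed_closure.
- by rewrite -[L]setCK; exact: subsetC.
- by apply/disjoints_subset; rewrite setCK; exact: subset_closure.
Qed.

(** A component [D] of the complement of a closed set [P] is open; if it did not
touch [P], it would also be closed. *)
Lemma component_compl_adherent P D : closed P -> P !=set0 ->
  components (~` P) D -> closure D `&` P !=set0.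
Proof.
move=> cP [p Pp] PD; apply/set0P/eqP => /disjoints_subset DP.
have oD : open D by apply: components_open PD; exact: closed_openC.
have cD : closed D.
  suff -> : D = closure D by exact: closed_closure.
  apply/seteqP; split; first exact: subset_closure.
  have [x Dx] := components_neq0 PD.
  apply: (components_max PD) DP _.
    exact/connected_closure/(components_connected PD).
  by exists x; split=> //; exact: subset_closure.
have DT := clopen_full oD cD (components_neq0 PD).
by have : D p by [rewrite DT]; move=> /(components_sub PD); apply.
Qed.

Lemma connectedU_component P D : connected P -> P !=set0 ->
  closed P \/ open P -> components (~` P) D -> connected (P `|` D).
Proof.
move=> Pc P0 [cP|oP] PD; have Dc := components_connected PD.
  rewrite setUC; apply: connectedU_closure => //.
  exact: component_compl_adherent PD.
(* Here [D] is closed; away from the closure of [P] it would be open as well, by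
   local connectedness. *)
apply: connectedU_closure => //; apply/set0P/eqP; rewrite setIC.
move=> /disjoints_subset DP.
have cD : closed D by apply: components_closed PD; exact: open_closedC.
have oD : open D.
  rewrite openE => x Dx.
  have /X_locally_connected[V [oV Vc Vx VP]] : nbhs x (~` closure P).
    apply: open_nbhs_nbhs; split; last exact: DP.
    exact/closed_openC/closed_closure.
  apply: filterS (open_nbhs_nbhs (conj oV Vx)).
  apply: (components_max PD Vc) => [|]; last by exists x.
  by apply: subset_trans VP _; apply: subsetC; exact: subset_closure.
have DT := clopen_full oD cD (components_neq0 PD).
by case: P0 => p Pp; have : D p by [rewrite DT]; move=> /(components_sub PD); apply.
Qed.

Lemma connected_fill P (F : set (set X)) : connected P -> P !=set0 ->
  closed P \/ open P -> F `<=` components (~` P) ->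
  connected (P `|` \bigcup_(D in F) D).
Proof.
move=> Pc P0 Pt FP; apply: connected_star => // D /FP.
exact: connectedU_component.
Qed.

Lemma setC_component P D : components (~` P) D ->
  ~` D = P `|` \bigcup_(E in components (~` P) `\ D) E.
Proof.
move=> PD; apply/seteqP; split=> x.
  move=> nDx; have [Px|nPx] := pselect (P x); first by left.
  right; exists (connected_component (~` P) x); last exact: connected_component_refl.
  split; first exact: component_in.
  by move=> /= ED; apply: nDx; rewrite -ED; exact: connected_component_refl.
move=> [Px Dx|[E [PE /= ED] Ex] Dx]; first exact: (components_sub PD Dx).
by apply: ED; apply: (components_eq PE PD); exists x.
Qed.

Lemma connected_setC_component P D : connected P -> P !=set0 ->
  closed P \/ open P -> components (~` P) D -> connected (~` D).
Proof.
move=> Pc P0 Pt PD; rewrite (setC_component PD).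
by apply: connected_fill => //; exact: subDsetl.
Qed.

(** The components that are not filled in avoid the filled set, and they remain
maximal in the smaller complement. *)
Lemma components_setC_fill P (F : set (set X)) : F `<=` components (~` P) ->
  components (~` (P `|` \bigcup_(D in F) D)) = components (~` P) `\` F.
Proof.
move=> FP; set H := P `|` _.
have HP : ~` H `<=` ~` P by apply: subsetC; exact: subsetUl.
have sub D : components (~` P) D -> ~ F D -> D `<=` ~` H.
  move=> PD nFD x Dx [Px|[E FE Ex]]; first exact: (components_sub PD Dx).
  by apply: nFD; rewrite (components_eq PD (FP _ FE)) //; exists x.
apply/seteqP; split=> D.
  move=> HD; have [x Dx] := components_neq0 HD; have nHx := components_sub HD Dx.
  have PE := component_in (HP _ nHx).
  set E := connected_component _ _ in PE.
  have Ex : E x by apply: connected_component_refl; exact: HP.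
  have nFE : ~ F E by move=> FE; apply: nHx; right; exists E.
  suff -> : D = E by split.
  have HE := components_restrict PE (sub _ PE nFE) HP.
  by apply: (components_eq HD HE); exists x.
by move=> [PD nFD]; exact: components_restrict (sub _ PD nFD) HP.
Qed.

Lemma compact_connected_between B L : open B -> connected B -> B !=set0 ->
  compact L -> L `<=` B ->
  exists C, [/\ compact C, connected C, C !=set0, L `<=` C & C `<=` B].
Proof.
move=> oB Bc [x0 Bx0] cL LB.
pose reach A := exists C, [/\ compact C, connected C, C x0, A `<=` C & C `<=` B].
have local y : B y -> exists W,
    [/\ open W, W y, connected (closure W), compact (closure W) & closure W `<=` B].
  move=> By; have [V [oV Vy bV VB]] := nbhs_bounded_open (open_nbhs_nbhs (conj oB By)).
  have [W [oW Wc Wy WV]] := X_locally_connected (open_nbhs_nbhs (conj oV Vy)).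
  exists W; split=> //; first exact: connected_closure.
    exact: bounded_sub bV.
  by apply: subset_trans VB; exact: closureS.
have extend y W : connected (closure W) -> compact (closure W) ->
    closure W `<=` B -> closure W y -> reach [set y] -> reach (closure W).
  move=> Wc cW WB Wy [C [cC Cc Cx0 Cy CB]]; exists (C `|` closure W); split.
  - exact: compactU.
  - by apply: connectedU => //; exists y; split=> //; exact: Cy.
  - by left.
  - exact: subsetUr.
  - by rewrite subUset.
have reachS A A' : A `<=` A' -> reach A' -> reach A.
  by move=> AA' [C [? ? ? AsubC ?]]; exists C; split=> //; exact: subset_trans AsubC.
(* The points joined to [x0] by a compact connected subset of [B] form a subset of
   [B] that is relatively open and relatively closed. *)
pose Z := [set y | B y /\ reach [set y]].
have ZB : Z = B.
  apply: Bc.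
  - exists x0; split=> //; exists [set x0]; split=> //; last by move=> _ ->.
      exact: compact_set1.
    exact: connected1.
  - exists Z; last by apply/seteqP; split=> [y [By Zy]|y []].
    rewrite openE => y [By ry]; have [W [oW Wy Wc cW WB]] := local _ By.
    apply: filterS (open_nbhs_nbhs (conj oW Wy)) => z Wz; split.
      exact/WB/subset_closure.
    apply: reachS (extend y W Wc cW WB (subset_closure Wy) ry).
    by move=> _ ->; exact: subset_closure.
  - exists (closure Z); first exact: closed_closure.
    apply/seteqP; split=> [y Zy|y [By clZy]].
      by split; [case: Zy|exact: subset_closure].
    split=> //; have [W [oW Wy Wc cW WB]] := local _ By.
    have [z [[Bz rz] Wz]] := clZy _ (open_nbhs_nbhs (conj oW Wy)).
    apply: reachS (extend z W Wc cW WB (subset_closure Wz) rz).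
    by move=> _ ->; exact: subset_closure.
suff : reach L by move=> [C [? ? ? ? ?]]; exists C; split=> //; exists x0.
apply: (@compact_induction _ reach _ _ reachS) cL.
- exists [set x0]; split=> //; last by move=> _ ->.
    exact: compact_set1.
  exact: connected1.
- move=> A A' [C [cC Cc Cx0 AsubC CB]] [C' [cC' Cc' Cx0' AsubC' CB']].
  exists (C `|` C'); split.
  + exact: compactU.
  + by apply: connectedU => //; exists x0.
  + by left.
  + exact: setUSS.
  + by rewrite subUset.
- move=> y /LB By; have [W [oW Wy Wc cW WB]] := local _ By.
  exists W; first exact: open_nbhs_nbhs.
  apply: reachS (extend y W Wc cW WB (subset_closure Wy) _).
    exact: subset_closure.
  by move: By; rewrite -{1}ZB => -[].
Qed.

Lemma connected_sub_open V D : open V -> connected D ->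
  D `&` (closure V `\` V) = set0 -> D `&` V !=set0 -> D `<=` V.
Proof.
move=> oV Dc Dbd [z [Dz Vz]].
have sep : separated V (~` closure V).
  apply: separated_open => //; first exact/closed_openC/closed_closure.
  by apply/disjoints_subset; rewrite setCK; exact: subset_closure.
have DVV : D `<=` V `|` ~` closure V.
  move=> t Dt; have [Vt|nVt] := pselect (V t); [by left|right => clVt].
  by suff : (D `&` (closure V `\` V)) t by [rewrite Dbd]; split.
have [//|DnV] := connected_subset sep DVV Dc.
by case: (DnV _ Dz); exact: subset_closure.
Qed.

(** Start from a finite union [C] of connected compact neighbourhoods inside a small
open set [V], and fill in the complementary components that stay inside [V]. Each
of the others meets the boundary of [V], which is compact and disjoint from [C], so
only finitely many remain. Filling in creates no component, because every
complementary component touches [C]. *)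
Lemma compact_finite_between K U : compact K -> open U -> K `<=` U ->
  exists N, [/\ compact N, K `<=` N°, N `<=` U,
    finite_set (components N) & finite_set (components (~` N))].
Proof.
move=> cK oU KU; have [V [oV KV bV VU]] := compact_bounded_open cK oU KU.
have [C [cC KC CV Cf]] : exists C,
    [/\ compact C, K `<=` C°, C `<=` V & finite_set (components C)].
  apply: (@compact_induction _ (fun A => exists C,
    [/\ compact C, A `<=` C°, C `<=` V & finite_set (components C)])) cK.
  - exists set0; split=> //; first exact: compact0.
    by rewrite components_set0.
  - by move=> A B AB [C [? BC ? ?]]; exists C; split=> //; exact: subset_trans BC.
  - move=> A B [C [cC AsubC CV Cf]] [D [cD BD DV Df]]; exists (C `|` D); split.
    + exact: compactU.
    + rewrite subUset; split.
        by apply: subset_trans AsubC _; apply: interiorS; exact: subsetUl.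
      by apply: subset_trans BD _; apply: interiorS; exact: subsetUr.
    + by rewrite subUset.
    + exact: finite_componentsU.
  - move=> x /KV Vx.
    have [W [oW Wx bW WV]] := nbhs_bounded_open (open_nbhs_nbhs (conj oV Vx)).
    have [Y [oY Yc Yx YW]] := X_locally_connected (open_nbhs_nbhs (conj oW Wx)).
    exists Y; first exact: open_nbhs_nbhs.
    exists (closure Y); split.
    + exact: bounded_sub bW.
    + by rewrite -open_subsetE //; exact: subset_closure.
    + by apply: subset_trans WV; exact: closureS.
    + rewrite components_of_connected; [exact: finite_set1|..].
        exact: connected_closure.
      by exists x; exact: subset_closure.
have [C0|/set0P C0] := eqVneq C set0.
  exists set0; split=> //.
  - exact: compact0.
  - by apply: subset_trans KC _; rewrite C0.
  - by rewrite components_set0.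
  - rewrite setC0; apply: (@finite_components_cover _ _ [set setT]).
    + exact: finite_set1.
    + by move=> _ ->.
    + by rewrite bigcup_set1.
have clC := compact_is_closed cC.
pose F := [set D | components (~` C) D /\ D `<=` V].
have FC : F `<=` components (~` C) by move=> D [].
have big_fin : finite_set (components (~` C) `\` F).
  (* The components are open and disjoint, so a compact set meets finitely many. *)
  pose bd := closure V `\` V.
  have cbd : compact bd.
    apply: subclosed_compact bV _; last exact: subDsetl.
    by rewrite /bd setDE; apply: closedI; [exact: closed_closure|exact: open_closedC].
  have meets D : (components (~` C) `\` F) D -> D `&` bd !=set0.
    move=> [CD nFD]; apply/set0P/eqP => Dbd.
    have [y [cDy Cy]] := component_compl_adherent clC C0 CD.
    have [z [Dz Vz]] := cDy V (open_nbhs_nbhs (conj oV (CV _ Cy))).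
    apply: nFD; split=> //.
    apply: (connected_sub_open oV _ Dbd); last by exists z.
    exact: components_connected CD.
  suff : finite_set [set D | components (~` C) D /\ D `&` bd !=set0].
    by apply: sub_finite_set => D FD; split; [case: FD|exact: meets].
  apply: (@compact_induction _ (fun A => finite_set
     [set D | components (~` C) D /\ D `&` A !=set0])) cbd.
  - by apply: sub_finite_set (finite_set0 _) => D [_ [x []]].
  - move=> A B AB; apply: sub_finite_set => D [CD [x [Dx Ax]]]; split=> //.
    by exists x; split=> //; exact: AB.
  - move=> A B fA fB; have : finite_set ([set D | components (~` C) D /\
        D `&` A !=set0] `|` [set D | components (~` C) D /\ D `&` B !=set0]).
      by rewrite finite_setU.
    apply: sub_finite_set => D [CD [x [Dx [Ax|Bx]]]]; [left|right];
      by split=> //; exists x.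
  - move=> x [_ nVx]; have nCx : (~` C) x by move=> /CV.
    have CD := component_in nCx.
    exists (connected_component (~` C) x).
      apply: open_nbhs_nbhs; split; last exact: connected_component_refl.
      by apply: components_open CD; exact: closed_openC.
    apply: sub_finite_set (finite_set1 (connected_component (~` C) x)) => D.
    by move=> [CD' DD] /=; exact: (components_eq CD' CD DD).
pose N := C `|` \bigcup_(D in F) D.
have NV : N `<=` V by move=> x [/CV//|[D [_ DV] /DV]].
have NE : ~` N = \bigcup_(D in components (~` C) `\` F) D.
  by rewrite -(components_cover (~` N)) (components_setC_fill FC).
have clN : closed N.
  rewrite -openC NE; apply: open_bigcup_set => D [CD _].
  by apply: components_open CD; exact: closed_openC.
exists N; split.
- apply: (subclosed_compact clN bV); apply: subset_trans NV _.
  exact: subset_closure.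
- by apply: subset_trans KC _; apply: interiorS; exact: subsetUl.
- by apply: subset_trans NV _; apply: subset_trans VU; exact: subset_closure.
- apply: (finite_components Cf) => [Q CQ|D ND].
    split; first exact: components_connected CQ.
    by apply: subset_trans (components_sub CQ) _; exact: subsetUl.
  suff [x [Dx Cx]] : D `&` C !=set0.
    exists (connected_component C x); first exact: component_in.
    by exists x; split=> //; exact: connected_component_refl.
  have [x Dx] := components_neq0 ND.
  have [Cx|[E [CE EV] Ex]] := components_sub ND Dx; first by exists x.
  have [y [cEy Cy]] := component_compl_adherent clC C0 CE.
  exists y; split=> //; apply: (components_max ND _ _ _ cEy).
  + exact/connected_closure/(components_connected CE).
  + rewrite (closure_id N).1//; apply: closureS => z Ez; right.
    by exists E.
  + by exists x; split=> //; exact: subset_closure.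
- by rewrite (components_setC_fill FC).
Qed.

(** * Solid sets and cells *)

Section Solid.

(** The complementary components that are not holes: [big] means unbounded if the
space is not compact, and containing a fixed point if it is. *)
Variable big : set (set X).
Hypothesis big_mono : forall A B, A `<=` B -> big A -> big B.
Hypothesis not_big_bounded : forall A, ~ big A -> bounded_subset A.
Hypothesis not_big_setC : forall A, ~ big A -> big (~` A).

(** Solid sets relative to [big]: they have no holes. In a compact space these are
the whole space and the solid sets that miss the fixed point. *)
Definition bsolid A := [/\ connected A,
  compact A \/ (open A /\ bounded_subset A) & components (~` A) `<=` big].

Definition holes P := components (~` P) `\` big.

Definition hull P := P `|` \bigcup_(B in holes P) B.

Lemma big_setT : big setT.
Proof.
by apply: contrapT => nb; apply: (nb); apply: big_mono (not_big_setC nb).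
Qed.

Lemma bounded_type A : compact A \/ (open A /\ bounded_subset A) ->
  bounded_subset A.
Proof. by case=> [/compact_bounded|[]]. Qed.

Lemma closed_or_open_type A : compact A \/ (open A /\ bounded_subset A) ->
  closed A \/ open A.
Proof. by case=> [/compact_is_closed|[]]; [left|right]. Qed.

Lemma connected_components_eq A D : connected A -> components A D -> D = A.
Proof.
move=> Ac AD; have [x Dx] := components_neq0 AD.
rewrite (componentsE AD Dx); apply: connected_component_id => //.
exact: components_sub AD _ Dx.
Qed.

Lemma bsolid0 : bsolid set0.
Proof.
split; [exact: connected0|by left; exact: compact0|].
by move=> D; rewrite setC0 => /(connected_components_eq X_connected)->; exact: big_setT.
Qed.

Lemma holes_bsolid A : bsolid A -> holes A = set0.
Proof. by case=> _ _ bA; apply/seteqP; split=> // D [/bA]. Qed.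

Lemma hull_bsolid A : bsolid A -> hull A = A.
Proof. by move=> sA; rewrite /hull holes_bsolid// bigcup_set0 setU0. Qed.

Lemma holes_sub P : holes P `<=` components (~` P).
Proof. exact: subDsetl. Qed.

Lemma sub_hull P : P `<=` hull P.
Proof. exact: subsetUl. Qed.

Lemma hole_sub_hull P B : holes P B -> B `<=` hull P.
Proof. by move=> PB x Bx; right; exists B. Qed.

Lemma components_setC_hull P : components (~` hull P) `<=` big.
Proof.
move=> D; rewrite (components_setC_fill (@holes_sub P)) => -[PD nhD].
by apply: contrapT => nbD; apply: nhD.
Qed.

(** A hole of [P] that left [S] would swallow a big component of the complement
of [S]. *)
Lemma hole_sub P S B : P `<=` S -> components (~` S) `<=` big -> holes P B ->
  B `<=` S.
Proof.
move=> PS bS [PB nbB] x Bx; apply: contrapT => nSx; apply: nbB.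
apply: big_mono (bS _ (component_in nSx)).
apply: (components_max PB); first exact: component_connected.
  by apply: subset_trans (subsetC PS); exact: connected_component_sub.
by exists x; split=> //; exact: connected_component_refl.
Qed.

Lemma hull_sub P S : P `<=` S -> components (~` S) `<=` big -> hull P `<=` S.
Proof. by move=> PS bS x [/PS//|[B hB Bx]]; exact: (hole_sub PS bS hB). Qed.

(** For compact [P] the complement of the hull is a union of open components, so the
hull is closed even if there are infinitely many holes. *)
Lemma bsolid_hull_compact P : compact P -> connected P -> P !=set0 ->
  bounded_subset (hull P) -> compact (hull P) /\ bsolid (hull P).
Proof.
move=> cP Pc P0 bH; have clP := compact_is_closed cP.
have cH : compact (hull P).
  apply: closed_bounded_compact => //; rewrite -openC.
  rewrite -(components_cover (~` hull P)) (components_setC_fill (@holes_sub P)).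
  apply: open_bigcup_set => D [PD _]; apply: components_open PD.
  exact: closed_openC.
split=> //; split; [|by left|exact: components_setC_hull].
by apply: connected_fill => //; [left|exact: holes_sub].
Qed.

(** Take the hull of a connected compact set between [L] and [B]; it does not leave
[B] because [B] has no holes. *)
Lemma bsolid_compact_between B L : bsolid B -> open B -> compact L -> L `<=` B ->
  exists K, [/\ compact K, bsolid K, L `<=` K & K `<=` B].
Proof.
move=> [Bc Bt bB] oB cL LB; have [B0|/set0P B0] := eqVneq B set0.
  exists set0; split=> //; [exact: compact0|exact: bsolid0|].
  by rewrite -B0.
have [C [cC Cc C0 LC CB]] := compact_connected_between oB Bc B0 cL LB.
have HB := hull_sub CB bB.
have bH := bounded_sub HB (bounded_type Bt).
have [cH sH] := bsolid_hull_compact cC Cc C0 bH.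
by exists (hull C); split=> //; apply: subset_trans LC _; exact: sub_hull.
Qed.

(** The sets whose value is forced by additivity; the nonempty solid sets are the cells
without holes. *)
Definition cell P := [/\ P !=set0, connected P, finite_set (holes P),
  bsolid (hull P) & holes P `<=` bsolid].

Lemma bsolid_cell A : bsolid A -> A !=set0 -> cell A.
Proof.
by move=> sA A0; rewrite /cell hull_bsolid// holes_bsolid//; case: (sA).
Qed.

(** A hole [B] has a connected complement, made of [P] and the other components that
touch it, and this complement is big. *)
Lemma bsolid_hole P B : connected P -> P !=set0 ->
  compact P \/ (open P /\ bounded_subset P) -> holes P B -> bsolid B.
Proof.
move=> Pc P0 Pt [PB nbB]; split.
- exact: components_connected PB.
- have bB := not_big_bounded nbB; case: Pt => [cP|[oP _]]; [right|left].
    by split=> //; apply: components_open PB; exact/closed_openC/(compact_is_closed cP).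
  apply: closed_bounded_compact => //; apply: components_closed PB.
  exact: open_closedC.
- move=> D BD; rewrite (connected_components_eq _ BD); first exact: not_big_setC nbB.
  exact: (connected_setC_component Pc P0 (closed_or_open_type Pt) PB).
Qed.

Lemma finite_components_cell P : connected P -> P !=set0 ->
  compact P \/ (open P /\ bounded_subset P) ->
  finite_set (components (~` P)) -> cell P.
Proof.
move=> Pc P0 Pt fP; have fh : finite_set (holes P).
  exact: sub_finite_set (@holes_sub P) fP.
split=> //; last by move=> B; exact: bsolid_hole.
have bH : bounded_subset (hull P).
  apply: boundedU; first exact: bounded_type.
  by apply: bounded_bigcup => // B [_ /not_big_bounded].
case: (Pt) => [cP|[oP bP]]; first by case: (bsolid_hull_compact cP Pc P0 bH).
split; last exact: components_setC_hull.
  by apply: connected_fill => //; [right|exact: holes_sub].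
right; split=> //; rewrite -closedC.
rewrite -(components_cover (~` hull P)) (components_setC_fill (@holes_sub P)).
apply: closed_bigcup_set; first exact: sub_finite_set fP.
by move=> D [PD _]; apply: components_closed PD; exact: open_closedC.
Qed.

(** * The extension to cells *)

Variables (R : realType) (lam : set X -> R).
(** What the axioms of a solid-set function give for solid sets relative to [big]. *)
Hypothesis lam_superadd : forall (n : nat) (D : 'I_n -> set X) C,
  compact C -> bsolid C -> (forall i, compact (D i) /\ bsolid (D i)) ->
  trivIset setT D -> (forall i, D i `<=` C) -> \sum_(i < n) lam (D i) <= lam C.
Hypothesis lam_inner : forall U (e : R), open U -> bsolid U -> 0 < e ->
  exists K, [/\ compact K, bsolid K, K `<=` U & lam U <= lam K + e].
Hypothesis lam_outer : forall K (e : R), compact K -> bsolid K -> 0 < e ->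
  exists U, [/\ open U, bsolid U, K `<=` U & lam U <= lam K + e].
Hypothesis lam_add : forall (n : nat) (D : 'I_n -> set X) A,
  bsolid A -> (forall i, bsolid (D i)) -> trivIset setT D ->
  A = \bigcup_i D i -> lam A = \sum_(i < n) lam (D i).

Hypothesis lam_mono : forall K U, compact K -> bsolid K -> open U -> bsolid U ->
  K `<=` U -> lam K <= lam U.

Implicit Types F G : set (set X).

Lemma lam0 : lam set0 = 0.
Proof.
rewrite (@lam_add 0%N (fun=> set0) set0 bsolid0 (fun=> bsolid0)) ?big_ord0//.
  by move=> [].
by apply/seteqP; split=> // x [].
Qed.

(** If [S] is open, a compact solid subset of [S] around all the [D i] takes its
place. *)
Lemma lam_compact_sum_le n (D : 'I_n -> set X) S : bsolid S ->
  (forall i, compact (D i) /\ bsolid (D i)) -> trivIset setT D ->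
  (forall i, D i `<=` S) -> \sum_(i < n) lam (D i) <= lam S.
Proof.
move=> sS cD tD DS; case: (sS) => _ [cS|[oS bS]] _; first exact: lam_superadd.
pose L := \big[setU/set0]_(i < n) D i.
have cL : compact L by apply: bigsetU_compact => i _; case: (cD i).
have LS : L `<=` S.
  apply: (@big_ind _ (fun A => A `<=` S)) => [//|A B AS BS|i _]; last exact: DS.
  by rewrite subUset.
have [K [cK sK LK KS]] := bsolid_compact_between sS oS cL LS.
apply: le_trans (lam_mono cK sK oS sS KS); apply: lam_superadd => // i.
by apply: subset_trans LK; rewrite /L (bigD1 i)//=; exact: subsetUl.
Qed.

Lemma lam_sum_le n (D : 'I_n -> set X) S : bsolid S -> (forall i, bsolid (D i)) ->
  trivIset setT D -> (forall i, D i `<=` S) -> \sum_(i < n) lam (D i) <= lam S.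
Proof.
move=> sS sD tD DS; apply/ler_addgt0Pr => e e0.
(* The error of each of the [n] approximations; [n.+1] avoids dividing by zero. *)
pose d := e / n.+1%:R.
have d0 : 0 < d by rewrite divr_gt0.
have /choice[K HK] : forall i, exists K,
    [/\ compact K, bsolid K, K `<=` D i & lam (D i) <= lam K + d].
  move=> i; case: (sD i) => _ [cD|[oD _]] _; last exact: lam_inner.
  by exists (D i); split=> //; rewrite lerDl ltW.
apply: (@le_trans _ _ (\sum_(i < n) (lam (K i) + d))).
  by apply: ler_sum => i _; case: (HK i).
rewrite big_split /= sumr_const card_ord; apply: lerD; last first.
  rewrite -[d *+ n]mulr_natr /d -mulrA; apply: ler_piMr; first exact: ltW.
  by rewrite ler_pdivrMl// mulr1 ler_nat.
apply: lam_compact_sum_le => // [i|i j _ _ [x [Kix Kjx]]|i].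
- by case: (HK i).
- apply: tD => //; exists x; split; first by case: (HK i) => _ _ + _; exact.
  by case: (HK j) => _ _ + _; exact.
- by apply: subset_trans (DS i); case: (HK i).
Qed.

Lemma lam_fsum F S : finite_set F -> trivIset F id -> bsolid S ->
  (forall A, F A -> bsolid A /\ A `<=` S) ->
  \sum_(A \in F) lam A <= lam S /\
  (S `<=` \bigcup_(A in F) A -> \sum_(A \in F) lam A = lam S).
Proof.
move=> fF tF sS FS; have [n [D [injD rD ->]]] := fsum_enum R fF.
have FD i : F (D i) by rewrite -rD; exists i.
have tD : trivIset setT D.
  by move=> i j _ _ Dij; apply: injD; exact: (tF _ _ (FD i) (FD j) Dij).
split; first by apply: lam_sum_le => // i; case: (FS _ (FD i)).
move=> SF; apply/esym/lam_add => // [i|]; first by case: (FS _ (FD i)).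
apply/seteqP; split=> [x /SF[A]|x [i _ Dx]]; last by have [_] := FS _ (FD i); exact.
by rewrite -rD => -[i _ <-] Dx; exists i.
Qed.

Definition mu_cell P := lam (hull P) - \sum_(B \in holes P) lam B.

Lemma mu_cell_bsolid A : bsolid A -> mu_cell A = lam A.
Proof. by move=> sA; rewrite /mu_cell hull_bsolid// holes_bsolid// fsbig_set0 subr0. Qed.

(** Induction on a list [s] that contains the nonsolid members of [F]. If [P] is such
a member, each hole [B] of [P] is solid, and the members of [F] inside [B] form a
family to which the induction hypothesis applies with [B] as container, since [P] is
not among them. Every other member of [F] is [P] or misses the hull [H] of [P], by
connectedness; replacing [P] and all that lies in its holes by the solid set [H]
gives a second family without [P]. As [mu_cell P] is [lam H] minus the values of the
holes, the two conclusions add up to the claim. *)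
Lemma mu_cell_fsum_seq (s : seq (set X)) F S : bsolid S -> finite_set F ->
  trivIset F id -> (forall P, F P -> cell P /\ P `<=` S) ->
  (forall P, F P -> ~ bsolid P -> P \in s) ->
  \sum_(P \in F) mu_cell P <= lam S /\
  (S `<=` \bigcup_(P in F) P -> \sum_(P \in F) mu_cell P = lam S).
Proof.
elim: s F S => [|P s IH] F S sS fF tF FS Fs.
  have sF P : F P -> bsolid P.
    by move=> FP; apply: contrapT => /(Fs _ FP); rewrite in_nil.
  have -> : \sum_(P \in F) mu_cell P = \sum_(P \in F) lam P.
    by apply: eq_fsbigr => P; rewrite inE => /sF; exact: mu_cell_bsolid.
  by apply: lam_fsum => // P FP; split; [exact: sF|case: (FS _ FP)].
have [[FP nsP]|nFP] := pselect (F P /\ ~ bsolid P); last first.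
  apply: IH => // Q FQ nsQ; have := Fs _ FQ nsQ; rewrite inE => /orP[/eqP QP|//].
  by case: nFP; rewrite -QP.
have Fs' Q : F Q -> Q <> P -> ~ bsolid Q -> Q \in s.
  move=> FQ QP nsQ; have := Fs _ FQ nsQ; rewrite inE => /orP[/eqP//|//].
have [[P0 Pc fh sH hs] PS] := FS _ FP; set H := hull P in sH.
have HS : H `<=` S by apply: hull_sub => //; case: sS.
have disj Q x : F Q -> Q <> P -> Q x -> ~ P x.
  by move=> FQ QP Qx Px; apply: QP; apply: (tF _ _ FQ FP); exists x.
have in_hole Q B x : F Q -> Q <> P -> holes P B -> Q x -> B x -> Q `<=` B.
  move=> FQ QP [PB _] Qx Bx; have [[_ Qc _ _ _] _] := FS _ FQ.
  by apply: (components_max PB) => // [y|]; [exact: disj|exists x].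
pose sub B := F `&` [set Q | Q `<=` B].
have fsub B : finite_set (sub B) by apply: finite_setIl.
have subP B Q : holes P B -> sub B Q -> F Q /\ Q <> P.
  move=> [PB _] [FQ QB]; split=> // QP; have [x Px] := P0.
  by apply: (components_sub PB (QB x _)); rewrite ?QP.
pose rest := F `&` [set Q | Q `&` H = set0].
have frest : finite_set rest by apply: finite_setIl.
(* The members of [F] in the holes of [P]. *)
pose inn := F `&` [set Q | exists2 B, holes P B & Q `<=` B].
have finn : finite_set inn by apply: finite_setIl.
have restP Q : rest Q -> F Q /\ Q <> P.
  move=> [FQ QH]; split=> // QP; have [x Px] := P0.
  suff : (Q `&` H) x by rewrite QH.
  by rewrite QP; split=> //; exact: sub_hull.
have innP Q : inn Q -> F Q /\ Q <> P.
  by move=> [FQ [B hB QB]]; exact: (subP B).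
have FE : F `\ P = rest `|` inn.
  apply/seteqP; split=> Q; last by move=> [/restP|/innP].
  move=> [FQ /= QP]; have [QH|/set0P[x [Qx Hx]]] := eqVneq (Q `&` H) set0.
    by left.
  right; split=> //; case: Hx => [/(disj _ _ FQ QP Qx)//|[B hB Bx]].
  by exists B => //; exact: in_hole hB Qx Bx.
have H_neq0 : H !=set0 by case: P0 => x Px; exists x; exact: sub_hull.
have nrestH : ~ rest H.
  by case: H_neq0 => x Hx [_ /= HH]; suff : (H `&` H) x by rewrite HH.
have sumF : \sum_(Q \in F) mu_cell Q = mu_cell P + \sum_(Q \in rest) mu_cell Q +
    \sum_(B \in holes P) \sum_(Q \in sub B) mu_cell Q.
  rewrite (fsbigD1 P)//= FE fsbigU0//; last first.
    move=> Q [[_ /= QH] [FQ [B hB QB]]]; have [[[x Qx] _ _ _ _] _] := FS _ FQ.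
    suff : (Q `&` H) x by rewrite QH.
    by split=> //; apply: hole_sub_hull hB _ _; exact: QB.
  rewrite addrA; congr (_ + _).
  rewrite (@fsum_group _ _ _ inn (holes P) (fun B => [set Q | Q `<=` B]))//.
  - apply: eq_fsbigr => B; rewrite inE => hB; apply: eq_fsbigl.
    apply/seteqP; split=> Q; first by move=> [[FQ _] QB].
    by move=> [FQ QB]; split=> //; split=> //; exists B.
  - by move=> Q [_ []] B; exists B.
  - move=> Q B C [FQ _] [PB _] [PC _] /= QB QC.
    have [[[x Qx] _ _ _ _] _] := FS _ FQ.
    by apply: (components_eq PB PC); exists x; split; [exact: QB|exact: QC].
pose F' := H |` rest.
have fF' : finite_set F' by rewrite finite_setU; split=> //; exact: finite_set1.
have sumF' : \sum_(Q \in F') mu_cell Q = lam H + \sum_(Q \in rest) mu_cell Q.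
  rewrite fsbigU0//; last by move=> Q [-> /nrestH].
  by rewrite fsbig_set1 mu_cell_bsolid.
have [leF' eqF'] : \sum_(Q \in F') mu_cell Q <= lam S /\
    (S `<=` \bigcup_(Q in F') Q -> \sum_(Q \in F') mu_cell Q = lam S).
  apply: IH => //.
  - move=> A B [->|[FA AH]] [->|[FB BH]] //.
    + by move=> [x [Hx Bx]]; suff : (B `&` H) x by rewrite BH.
    + by move=> [x [Ax Hx]]; suff : (A `&` H) x by rewrite AH.
    + exact: tF.
  - by move=> Q [->|[/FS]//]; split=> //; exact: bsolid_cell.
  - by move=> Q [->//|/restP[FQ QP]]; exact: Fs'.
have IHB B : holes P B -> \sum_(Q \in sub B) mu_cell Q <= lam B /\
    (B `<=` \bigcup_(Q in sub B) Q -> \sum_(Q \in sub B) mu_cell Q = lam B).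
  move=> hB; apply: IH => //.
  - exact: hs.
  - by move=> A C [FA _] [FC _]; exact: tF.
  - by move=> Q [FQ QB]; split=> //; case: (FS _ FQ).
  - by move=> Q /(subP _ _ hB)[FQ QP]; exact: Fs'.
rewrite sumF; split=> [|SF].
  apply: le_trans leF'; rewrite sumF' /mu_cell -/H addrAC lerD2r.
  rewrite -addrA gerDl addrC subr_le0.
  by apply: fsum_le => // B /IHB[].
rewrite -eqF' => [|x /SF[Q FQ Qx]].
  rewrite sumF' /mu_cell -/H (_ : \sum_(B \in holes P) \sum_(Q \in sub B) mu_cell Q =
    \sum_(B \in holes P) lam B); first by rewrite addrAC subrK.
  apply: eq_fsbigr => B; rewrite inE => hB; have [_ ->//] := IHB _ hB.
  move=> x Bx; have /SF[Q FQ Qx] : S x by exact/HS/(hole_sub_hull hB).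
  exists Q => //; split=> //; apply: (in_hole _ _ _ FQ _ hB Qx Bx) => QP.
  by case: hB => PB _; apply: (components_sub PB Bx); rewrite -QP.
have [QP|QP] := pselect (Q = P); first by exists H; [left|apply: sub_hull; rewrite -QP].
have : (F `\ P) Q by split.
rewrite FE => -[rQ|[_ [B hB QB]]]; first by exists Q => //; right.
by exists H; [left|apply: hole_sub_hull hB _ _; exact: QB].
Qed.

Lemma mu_cell_fsum F S : bsolid S -> finite_set F -> trivIset F id ->
  (forall P, F P -> cell P /\ P `<=` S) ->
  \sum_(P \in F) mu_cell P <= lam S /\
  (S `<=` \bigcup_(P in F) P -> \sum_(P \in F) mu_cell P = lam S).
Proof.
move=> sS fF tF FS; have [s Fs] := (finite_seqP F).1 fF.
by apply: (@mu_cell_fsum_seq s) => // P; rewrite {1}Fs.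
Qed.

(** The cells in [C] together with the holes of [C] are disjoint cells in the solid
set [hull C], so the holes cancel. *)
Lemma mu_cell_fsum_cell F C : cell C -> finite_set F -> trivIset F id ->
  (forall P, F P -> cell P /\ P `<=` C) ->
  \sum_(P \in F) mu_cell P <= mu_cell C /\
  (C `<=` \bigcup_(P in F) P -> \sum_(P \in F) mu_cell P = mu_cell C).
Proof.
move=> [C0 Cc fh sH hs] fF tF FC; pose G := F `|` holes C.
have hC B x : holes C B -> B x -> ~ C x by move=> [CB _] /(components_sub CB).
have F0 P : F P -> P !=set0 by move=> /FC[[]].
have hcell B : holes C B -> cell B.
  by move=> hB; apply: bsolid_cell; [exact: hs|case: hB => /components_neq0].
have tG : trivIset G id.
  move=> P Q [FP|hP] [FQ|hQ] [x [Px Qx]].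
  - by apply: tF => //; exists x.
  - by case: (hC _ _ hQ Qx); case: (FC _ FP) => _; exact.
  - by case: (hC _ _ hP Px); case: (FC _ FQ) => _; exact.
  - by case: hP hQ => CP _ [CQ _]; apply: (components_eq CP CQ); exists x.
have [leG eqG] : \sum_(P \in G) mu_cell P <= lam (hull C) /\
    (hull C `<=` \bigcup_(P in G) P -> \sum_(P \in G) mu_cell P = lam (hull C)).
  apply: mu_cell_fsum => //; first by rewrite finite_setU.
  move=> P [/FC[cP PC]|hP]; split=> //.
  - by apply: subset_trans PC _; exact: sub_hull.
  - exact: hcell.
  - exact: hole_sub_hull.
have sumG : \sum_(P \in G) mu_cell P =
    \sum_(P \in F) mu_cell P + \sum_(B \in holes C) lam B.
  rewrite fsbigU0//; last first.
    move=> P [FP hP]; have [x Px] := F0 _ FP.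
    by case: (hC _ _ hP Px); case: (FC _ FP) => _; exact.
  by congr (_ + _); apply: eq_fsbigr => B; rewrite inE => /hs/mu_cell_bsolid.
rewrite /mu_cell lerBrDr -/mu_cell -sumG; split=> // CF.
apply/eqP; rewrite -subr_eq opprK -sumG; apply/eqP/eqG => x [/CF[P FP Px]|[B hB Bx]].
  by exists P => //; left.
by exists B => //; right.
Qed.

(** Finiteness on both sides makes the components of [A] cells, and these sets are
stable under the cutting operations used below. *)
Definition nice A := [/\ compact A \/ (open A /\ bounded_subset A),
  finite_set (components A) & finite_set (components (~` A))].

Definition mu_nice A := \sum_(P \in components A) mu_cell P.

(** The complement of a component of [A] consists of the complement of [A] and of the
other components, which is again finitely many connected sets. *)
Lemma nice_cell A P : nice A -> components A P -> cell P.
Proof.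
move=> [At fA fcA] AP; have PA := components_sub AP.
apply: finite_components_cell.
- exact: components_connected AP.
- exact: components_neq0 AP.
- case: At => [cA|[oA bA]]; [left|right].
    by apply: subclosed_compact PA => //; apply: components_closed AP; exact: compact_is_closed.
  by split; [exact: components_open AP|exact: bounded_sub bA].
- have -> : ~` P = ~` A `|` \bigcup_(Q in components A `\ P) Q.
    apply/seteqP; split=> x.
      move=> nPx; have [Ax|nAx] := pselect (A x); last by left.
      right; exists (connected_component A x); last exact: connected_component_refl.
      split; first exact: component_in.
      by move=> /= E; apply: nPx; rewrite -E; exact: connected_component_refl.
    move=> [nAx /PA//|[Q [AQ /= QP] Qx] Px]; apply: QP.
    by apply: (components_eq AQ AP); exists x.
  by apply: finite_componentsU => //; apply: finite_components_sub fA _; exact: subDsetl.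
Qed.

Lemma mu_nice_fsum F A : nice A -> finite_set F -> trivIset F id ->
  (forall P, F P -> cell P /\ P `<=` A) ->
  \sum_(P \in F) mu_cell P <= mu_nice A /\
  (A `<=` \bigcup_(P in F) P -> \sum_(P \in F) mu_cell P = mu_nice A).
Proof.
move=> nA fF tF FA; have [_ fA _] := nA.
have comp P C x : F P -> components A C -> P x -> C x -> P `<=` C.
  move=> FP AC' Px Cx; have [[_ Pc _ _ _] PA] := FA _ FP.
  by apply: (components_max AC') => //; exists x.
have -> : \sum_(P \in F) mu_cell P =
    \sum_(C \in components A) \sum_(P \in F `&` [set P | P `<=` C]) mu_cell P.
  apply: fsum_group => //.
    move=> P FP; have [[[x Px] _ _ _ _] PA] := FA _ FP.
    have AC' := component_in (PA _ Px); exists (connected_component A x) => //=.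
    by apply: (comp _ _ x) => //; exact/connected_component_refl/PA.
  move=> P C D FP AC' AD /= PC PD; have [[[x Px] _ _ _ _] _] := FA _ FP.
  by apply: (components_eq AC' AD); exists x; split; [exact: PC|exact: PD].
have sub C : components A C ->
    \sum_(P \in F `&` [set P | P `<=` C]) mu_cell P <= mu_cell C /\
    (C `<=` \bigcup_(P in F `&` [set P | P `<=` C]) P ->
     \sum_(P \in F `&` [set P | P `<=` C]) mu_cell P = mu_cell C).
  move=> AC'; apply: mu_cell_fsum_cell.
  - exact: nice_cell AC'.
  - exact: finite_setIl.
  - by move=> P Q [FP _] [FQ _]; exact: tF.
  - by move=> P [FP PC]; split=> //; case: (FA _ FP).
split; first by apply: fsum_le => // C /sub[].
move=> AF; apply: eq_fsbigr => C; rewrite inE => AC'; have [_ ->//] := sub _ AC'.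
move=> x Cx; have [P FP Px] := AF _ (components_sub AC' Cx).
by exists P => //; split=> //; exact: comp Px Cx.
Qed.

Lemma nice_components A B : nice A -> A `<=` B ->
  forall P, components A P -> cell P /\ P `<=` B.
Proof.
move=> nA AB P AP; split; first exact: nice_cell AP.
exact: subset_trans (components_sub AP) AB.
Qed.

Lemma mu_nice_le A B : nice A -> nice B -> A `<=` B -> mu_nice A <= mu_nice B.
Proof.
move=> nA nB AB; have [_ fA _] := nA.
have [//] := mu_nice_fsum nB fA (@components_trivIset _ A) (nice_components nA AB).
Qed.

Lemma mu_niceU A B : nice A -> nice B -> nice (A `|` B) -> A `&` B = set0 ->
  mu_nice (A `|` B) = mu_nice A + mu_nice B.
Proof.
move=> nA nB nAB AB0; have [_ fA _] := nA; have [_ fB _] := nB.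
have disj P Q : components A P -> components B Q -> P `&` Q !=set0 -> False.
  move=> AP BQ [x [Px Qx]]; suff : (A `&` B) x by rewrite AB0.
  by split; [exact: components_sub AP _ Px|exact: components_sub BQ _ Qx].
rewrite {2 3}/mu_nice -fsbigU0//; last first.
  move=> P [AP BP]; apply: (disj P P AP BP); rewrite setIid.
  exact: components_neq0 AP.
have [||P|_ ->//] := @mu_nice_fsum (components A `|` components B) _ nAB.
- by rewrite finite_setU.
- move=> P Q [AP|BP] [AQ|BQ] PQ.
  + exact: components_eq AP AQ PQ.
  + by case: (disj P Q).
  + by rewrite setIC in PQ; case: (disj Q P).
  + exact: components_eq BP BQ PQ.
- move=> [AP|BP].
    exact: nice_components nA (@subsetUl _ A B) _ AP.
  exact: nice_components nB (@subsetUr _ A B) _ BP.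
- by rewrite bigcup_setU !components_cover.
Qed.

Lemma mu_nice_le_bsolid A S : nice A -> bsolid S -> A `<=` S -> mu_nice A <= lam S.
Proof.
move=> nA sS AS; have [_ fA _] := nA.
by have [] := mu_cell_fsum sS fA (@components_trivIset _ A) (nice_components nA AS).
Qed.

Lemma mu_nice_ge0 A : nice A -> 0 <= mu_nice A.
Proof.
move=> nA; have [||P []|] := @mu_nice_fsum set0 _ nA.
- exact: finite_set0.
- by move=> P Q [].
- by rewrite fsbig_set0.
Qed.

Lemma bsolid_le_mu_nice A S : nice A -> bsolid S -> S `<=` A -> lam S <= mu_nice A.
Proof.
move=> nA sS SA; have [->|/set0P S0] := eqVneq S set0.
  by rewrite lam0 mu_nice_ge0.
have [|||+ _] := @mu_nice_fsum [set S] _ nA.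
- exact: finite_set1.
- by move=> P Q -> ->.
- by move=> _ ->; split=> //; exact: bsolid_cell.
- by rewrite fsbig_set1 mu_cell_bsolid.
Qed.

(** * The measure *)

Lemma nice_between K U : compact K -> open U -> K `<=` U ->
  exists N, [/\ compact N, nice N, K `<=` N° & N `<=` U].
Proof.
move=> cK oU KU; have [N [cN KN NU fN fcN]] := compact_finite_between cK oU KU.
by exists N; split=> //; split=> //; left.
Qed.

Lemma nice_part N U V : compact N -> nice N -> open U -> open V ->
  U `&` V = set0 -> N `<=` U `|` V -> compact (N `&` U) /\ nice (N `&` U).
Proof.
move=> cN [_ fN fcN] oU oV UV0 NUV.
have part W : W = U \/ W = V -> N `&` W =
    \bigcup_(P in components N `&` [set P | P `<=` W]) P.
  move=> WUV; apply/seteqP; split=> x; last first.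
    by move=> [P [NP PW] Px]; split; [exact: components_sub NP _ Px|exact: PW].
  move=> [Nx Wx]; have NP := component_in Nx.
  exists (connected_component N x); last exact: connected_component_refl.
  split=> //=; have Px := connected_component_refl Nx.
  have PUV := subset_trans (components_sub NP) NUV.
  have disj y : U y -> V y -> False.
    by move=> Uy Vy; suff : (U `&` V) y by rewrite UV0.
  have [PU|PV] := connected_subset (separated_open oU oV UV0) PUV
    (components_connected NP).
    by case: WUV Wx => -> Wx //; case: (disj _ (PU _ Px) Wx).
  by case: WUV Wx => -> Wx //; case: (disj _ Wx (PV _ Px)).
have finpart W : W = U \/ W = V -> finite_set (components (N `&` W)).
  move=> /part->; apply: (finite_components_sub fN); exact: subIsetl.
have cNU : compact (N `&` U).
  have -> : N `&` U = N `\` V.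
    apply/seteqP; split=> x [Nx]; last by have [//|] := NUV _ Nx.
    by move=> Ux; split=> // Vx; suff : (U `&` V) x by rewrite UV0.
  apply: (subclosed_compact _ cN (@subDsetl _ _ _)).
  by rewrite setDE; apply: closedI; [exact: compact_is_closed|exact: open_closedC].
split=> //; split; [by left|by apply: finpart; left|].
have -> : ~` (N `&` U) = ~` N `|` (N `&` V).
  apply/seteqP; split=> x; last first.
    move=> [nNx [/nNx]//|[Nx Vx] [_ Ux]].
    by suff : (U `&` V) x by rewrite UV0.
  move=> nNU; have [Nx|] := pselect (N x); last by left.
  by right; split=> //; have [Ux|//] := NUV _ Nx; case: nNU.
by apply: finite_componentsU => //; apply: finpart; right.
Qed.

(** A nice neighbourhood of [K `|` L] inside [U `|` V] falls apart into its traces on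
[U] and [V], so that [P], [Q] and their union are nice at the same time. *)
Lemma nice_split K L U V : compact K -> compact L -> open U -> open V ->
  K `<=` U -> L `<=` V -> U `&` V = set0 ->
  exists P Q, [/\ compact P /\ nice P, compact Q /\ nice Q, nice (P `|` Q),
    K `<=` P° /\ P `<=` U & L `<=` Q° /\ Q `<=` V].
Proof.
move=> cK cL oU oV KU LV UV0.
have [N [cN nN KN NUV]] := nice_between (compactU cK cL) (openU oU oV) (setUSS KU LV).
have VU0 : V `&` U = set0 by rewrite setIC.
have NVU : N `<=` V `|` U by rewrite setUC.
exists (N `&` U), (N `&` V); split.
- exact: nice_part NUV.
- exact: nice_part NVU.
- by rewrite -setIUr (setIidl NUV).
- split; last exact: subIsetr.
  rewrite interiorI (interior_id U).1// => x Kx; split; last exact: KU.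
  by apply: KN; left.
- split; last exact: subIsetr.
  rewrite interiorI (interior_id V).1// => x Lx; split; last exact: LV.
  by apply: KN; right.
Qed.

Local Open Scope ereal_scope.

(** Approximation from outside by compact nice sets: monotonicity of [mu_nice] is then
the only regularity that nonsolid sets have to satisfy. *)
Definition mu_cpt K : \bar R :=
  ereal_inf [set (mu_nice N)%:E | N in [set N | [/\ compact N, nice N & K `<=` N°]]].

Lemma mu_cpt_le K N : compact N -> nice N -> K `<=` N° -> mu_cpt K <= (mu_nice N)%:E.
Proof. by move=> cN nN KN; apply: ereal_inf_lbound; exists N. Qed.

Lemma mu_cpt_ge K x : (forall N, compact N -> nice N -> K `<=` N° -> x <= (mu_nice N)%:E) ->
  x <= mu_cpt K.
Proof. by move=> H; apply: le_ereal_inf_tmp => _ [N [cN nN KN] <-]; exact: H. Qed.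

Lemma mu_cpt_ge0 K : 0 <= mu_cpt K.
Proof. by apply: mu_cpt_ge => N _ nN _; rewrite lee_fin; exact: mu_nice_ge0. Qed.

Lemma mu_cpt_fin_num K : compact K -> mu_cpt K \is a fin_num.
Proof.
move=> cK; rewrite ge0_fin_numE; last exact: mu_cpt_ge0.
have [N [cN nN KN _]] := nice_between cK openT (@subsetT _ K).
by apply: le_lt_trans (mu_cpt_le cN nN KN) _; exact: ltry.
Qed.

Lemma mu_cpt_mono K L : K `<=` L -> mu_cpt K <= mu_cpt L.
Proof.
by move=> KL; apply: mu_cpt_ge => N cN nN LN; apply: mu_cpt_le => //; exact: subset_trans LN.
Qed.

Lemma mu_cpt_adherent K e : compact K -> (0 < e)%R ->
  exists N, [/\ compact N, nice N, K `<=` N° & (mu_nice N)%:E <= mu_cpt K + e%:E].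
Proof.
move=> cK e0; have := lb_ereal_inf_adherent e0 (mu_cpt_fin_num cK).
by move=> [_ [N [cN nN KN] <-] /ltW leN]; exists N.
Qed.

Lemma mu_cptU K L : compact K -> compact L -> K `&` L = set0 ->
  mu_cpt (K `|` L) = mu_cpt K + mu_cpt L.
Proof.
move=> cK cL KL0; have [U [V [oU oV KU LV UV0]]] :=
  compact_separated cK (compact_is_closed cL) KL0.
have UV_disj A B : A `<=` U -> B `<=` V -> A `&` B = set0.
  by move=> AU BV; apply/seteqP; split=> // x [/AU Ux /BV Vx]; rewrite -UV0.
apply/eqP; rewrite eq_le; apply/andP; split.
  (* The nice neighbourhoods [P] and [Q] are chosen inside two nearly optimal ones,
     [M] and [N], so as to have a nice union. *)
  apply/lee_addgt0Pr => e e0; have e20 : (0 < e / 2)%R by rewrite divr_gt0.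
  have [M [cM nM KM leM]] := mu_cpt_adherent cK e20.
  have [N [cN nN LN leN]] := mu_cpt_adherent cL e20.
  have oM := open_interior M; have oN := open_interior N.
  have [P [Q [[cP nP] [cQ nQ] nPQ [KP PM] [LQ QN]]]] :
    exists P Q, [/\ compact P /\ nice P, compact Q /\ nice Q, nice (P `|` Q),
      K `<=` P° /\ P `<=` M° `&` U & L `<=` Q° /\ Q `<=` N° `&` V].
    apply: nice_split => //; try exact: openI.
    - by move=> x Kx; split; [exact: KM|exact: KU].
    - by move=> x Lx; split; [exact: LN|exact: LV].
    - by apply: UV_disj; exact: subIsetr.
  apply: (@le_trans _ _ (mu_nice (P `|` Q))%:E).
    apply: mu_cpt_le => //; first exact: compactU.
    rewrite subUset; split.
      by apply: subset_trans KP _; apply: interiorS; exact: subsetUl.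
    by apply: subset_trans LQ _; apply: interiorS; exact: subsetUr.
  rewrite mu_niceU//; last first.
    by apply: UV_disj; [move=> x /PM[]|move=> x /QN[]].
  have leP : (mu_nice P <= mu_nice M)%R.
    by apply: mu_nice_le => // x /PM[/interior_subset].
  have leQ : (mu_nice Q <= mu_nice N)%R.
    by apply: mu_nice_le => // x /QN[/interior_subset].
  rewrite [e]splitr EFinD (EFinD (e / 2)) addeACA; apply: leeD.
    by apply: le_trans leM; rewrite lee_fin.
  by apply: le_trans leN; rewrite lee_fin.
apply: mu_cpt_ge => N cN nN KLN; have oN := open_interior N.
have [P [Q [[cP nP] [cQ nQ] nPQ [KP PN] [LQ QN]]]] :
  exists P Q, [/\ compact P /\ nice P, compact Q /\ nice Q, nice (P `|` Q),
    K `<=` P° /\ P `<=` N° `&` U & L `<=` Q° /\ Q `<=` N° `&` V].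
  apply: nice_split => //; try exact: openI.
  - by move=> x Kx; split; [apply: KLN; left|exact: KU].
  - by move=> x Lx; split; [apply: KLN; right|exact: LV].
  - by apply: UV_disj; exact: subIsetr.
apply: (@le_trans _ _ (mu_nice (P `|` Q))%:E); last first.
  rewrite lee_fin; apply: mu_nice_le => // x [/PN|/QN] [] + _; exact: interior_subset.
rewrite mu_niceU//; last by apply: UV_disj; [move=> x /PN[]|move=> x /QN[]].
by rewrite EFinD; apply: leeD; apply: mu_cpt_le.
Qed.

Definition mu_opn U : \bar R := ereal_sup [set mu_cpt K | K in [set K | compact K /\ K `<=` U]].

Lemma mu_opn_ge U K : compact K -> K `<=` U -> mu_cpt K <= mu_opn U.
Proof. by move=> cK KU; apply: ereal_sup_ubound; exists K. Qed.

Lemma mu_opn_le U x : (forall K, compact K -> K `<=` U -> mu_cpt K <= x) -> mu_opn U <= x.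
Proof. by move=> H; apply: ge_ereal_sup => _ [K [cK KU] <-]; exact: H. Qed.

Lemma mu_opn_mono U V : U `<=` V -> mu_opn U <= mu_opn V.
Proof.
by move=> UV; apply: mu_opn_le => K cK KU; apply: mu_opn_ge => //; exact: subset_trans UV.
Qed.

Lemma mu_opn_ge0 U : 0 <= mu_opn U.
Proof.
apply: le_trans (mu_cpt_ge0 set0) _; apply: mu_opn_ge; first exact: compact0.
exact: sub0set.
Qed.

Lemma mu_opn_fin_num U : bounded_subset U -> mu_opn U \is a fin_num.
Proof.
move=> bU; rewrite ge0_fin_numE; last exact: mu_opn_ge0.
apply: (@le_lt_trans _ _ (mu_cpt (closure U))); last first.
  by rewrite -ge0_fin_numE; [exact: mu_cpt_fin_num|exact: mu_cpt_ge0].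
apply: mu_opn_le => K _ KU; apply: mu_cpt_mono; apply: subset_trans KU _.
exact: subset_closure.
Qed.

Lemma adde_mu_opn_le x U z : x \is a fin_num ->
  (forall K, compact K -> K `<=` U -> x + mu_cpt K <= z) -> x + mu_opn U <= z.
Proof.
move=> xf H; rewrite addeC -leeBrDr//; apply: mu_opn_le => K cK KU.
by rewrite leeBrDr// addeC; exact: H.
Qed.

Lemma mu_opnU U V : open U -> open V -> U `&` V = set0 -> mu_opn (U `|` V) = mu_opn U + mu_opn V.
Proof.
move=> oU oV UV0; apply/eqP; rewrite eq_le; apply/andP; split.
  apply: mu_opn_le => K cK KUV.
  have part A B : open B -> A `&` B = set0 -> K `<=` A `|` B -> compact (K `&` A).
    move=> oB AB0 KAB; have -> : K `&` A = K `\` B.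
      apply/seteqP; split=> x [Kx]; last by have [//|] := KAB _ Kx.
      by move=> Ax; split=> // Bx; suff : (A `&` B) x by rewrite AB0.
    apply: (subclosed_compact _ cK (@subDsetl _ _ _)).
    by rewrite setDE; apply: closedI; [exact: compact_is_closed|exact: open_closedC].
  have cKU := part U V oV UV0 KUV.
  have cKV : compact (K `&` V) by apply: (part V U); rewrite // 1?setIC 1?setUC.
  rewrite -(setIidl KUV) setIUr mu_cptU//; last first.
    by apply/seteqP; split=> // x [[_ Ux] [_ Vx]]; rewrite -UV0.
  by apply: leeD; apply: mu_opn_ge => //; exact: subIsetr.
rewrite addeC; have [moVy|moVy] := eqVneq (mu_opn V) +oo.
  rewrite moVy addye ?gt_eqF ?(lt_le_trans _ (mu_opn_ge0 U)) ?ltNyr//.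
  by rewrite -moVy; apply: mu_opn_mono; exact: subsetUr.
have moVf : mu_opn V \is a fin_num by rewrite ge0_fin_numE ?mu_opn_ge0// ltey.
apply: adde_mu_opn_le => // K cK KU; rewrite addeC.
apply: adde_mu_opn_le => [|L cL LV]; first exact: mu_cpt_fin_num.
rewrite -mu_cptU//; first by apply: mu_opn_ge; [exact: compactU|exact: setUSS].
by apply/seteqP; split=> // x [/KU Ux /LV Vx]; rewrite -UV0.
Qed.

(** Separate [K] and [K1] from the boundary [L] of a neighbourhood [Y] of both. Nice
neighbourhoods [P] of [K], inside [N], and [Q] of [L], away from [K1], cut [Y] into
[P], a part of [Q], and the open set [E], which is a union of components of the
complement of [P `|` Q] because [Q] covers [L]. Then [K1] lies in the nice open set
[P `|` E], whose value is that of [P] plus that of [E], and [E] stays inside a compact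
subset of [W] that misses [K]. *)
Lemma mu_cpt_le_nice_add W K K1 N : open W -> compact K -> K `<=` W -> compact K1 ->
  K1 `<=` W -> compact N -> nice N -> K `<=` N° ->
  mu_cpt K1 <= (mu_nice N)%:E + mu_opn (W `\` K).
Proof.
move=> oW cK KW cK1 K1W cN nN KN.
have KK1W : K `|` K1 `<=` W by rewrite subUset.
have [Y [oY KY bY YW]] := compact_bounded_open (compactU cK cK1) oW KK1W.
pose L := closure Y `\` Y.
have cL : compact L.
  apply: subclosed_compact bY (@subDsetl _ _ _).
  by rewrite /L setDE; apply: closedI; [exact: closed_closure|exact: open_closedC].
have [U [V [oU oV KU LV UV0]]] : exists U V,
    [/\ open U, open V, K `|` K1 `<=` U, L `<=` V & U `&` V = set0].
  apply: compact_separated; [exact: compactU|exact: compact_is_closed|].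
  by apply/seteqP; split=> // x [/KY Yx [_ nYx]].
have oN := open_interior N.
have [P [Q [[cP nP] [cQ nQ] nPQ [KP PU] [LQ QV]]]] :
  exists P Q, [/\ compact P /\ nice P, compact Q /\ nice Q, nice (P `|` Q),
    K `<=` P° /\ P `<=` N° `&` Y `&` U & L `<=` Q° /\ Q `<=` V].
  apply: nice_split => //.
  - by apply: openI => //; exact: openI.
  - move=> x Kx; split; first by split; [exact: KN|apply: KY; left].
    by apply: KU; left.
  - by apply/seteqP; split=> // x [[_ Ux] Vx]; rewrite -UV0.
have clPQ := compact_is_closed (compactU cP cQ).
pose F := components (~` (P `|` Q)) `&` [set D | D `<=` Y].
pose E := Y `\` (P `|` Q).
have oE : open E by rewrite /E setDE; apply: openI => //; exact: closed_openC.
have EF : E = \bigcup_(D in F) D.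
  apply/seteqP; split=> x; last first.
    by move=> [D [PQD DY] Dx]; split; [exact: DY|exact: components_sub PQD _ Dx].
  move=> [Yx nPQx]; have D := component_in (nPQx : (~` (P `|` Q)) x).
  have Dx := connected_component_refl (nPQx : (~` (P `|` Q)) x).
  exists (connected_component (~` (P `|` Q)) x) => //; split=> //=.
  apply: (connected_sub_open oY); first exact: component_connected.
    apply/seteqP; split=> // y [Dy Ly]; apply: (components_sub D Dy); right.
    exact: interior_subset (LQ _ Ly).
  by exists x.
have FPQ : F `<=` components (~` (P `|` Q)) by exact: subIsetl.
have [_ _ fcPQ] := nPQ.
(* The components of the complement of [P `|` Q] outside [Y]. *)
pose rest := \bigcup_(D in components (~` (P `|` Q)) `\` F) D.
have frest : finite_set (components rest).
  by apply: finite_components_sub fcPQ _; exact: subDsetl.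
have restP x : ~ (P `|` Q) x -> ~ E x -> rest x.
  move=> nPQx nEx; have D := component_in (nPQx : (~` (P `|` Q)) x).
  exists (connected_component (~` (P `|` Q)) x); last exact: connected_component_refl.
  split=> // FD; apply: nEx; rewrite EF.
  by exists (connected_component (~` (P `|` Q)) x) => //; exact: connected_component_refl.
have Prest x : rest x -> ~ (P `|` Q) x /\ ~ E x.
  move=> [D [PQD nFD] Dx]; split; first exact: components_sub PQD _ Dx.
  rewrite EF => -[D' FD' D'x]; apply: nFD.
  by rewrite (components_eq PQD (FPQ _ FD'))//; exists x.
have fE : finite_set (components E) by rewrite EF; exact: finite_components_sub fcPQ _.
have bE : bounded_subset E by apply: bounded_sub bY; exact: subDsetl.
have nE : nice E.
  split=> //; first by right.
  have -> : ~` E = (P `|` Q) `|` rest.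
    apply/seteqP; split=> x; last by move=> [PQx [_ /(_ PQx)]//|/Prest[]].
    by move=> nEx; have [PQx|/restP] := pselect ((P `|` Q) x); [left|right; auto].
  by apply: finite_componentsU => //; case: nPQ.
have PQ0 x : P x -> Q x -> False.
  by move=> /PU[_ Ux] /QV Vx; suff : (U `&` V) x by rewrite UV0.
have GE : P `|` E = Y `\` Q.
  apply/seteqP; split=> x.
    move=> [Px|[Yx nPQx]]; last by split=> // Qx; apply: nPQx; right.
    by split; [case: (PU _ Px) => -[]|move=> Qx; exact: (PQ0 x)].
  move=> [Yx nQx]; have [Px|nPx] := pselect (P x); [by left|right].
  by split=> // -[].
have oG : open (P `|` E).
  by rewrite GE setDE; apply: openI => //; exact/closed_openC/(compact_is_closed cQ).
have nG : nice (P `|` E).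
  split.
  - right; split=> //; rewrite GE; apply: bounded_sub bY; exact: subDsetl.
  - by apply: finite_componentsU => //; case: nP.
  have -> : ~` (P `|` E) = Q `|` rest.
    apply/seteqP; split=> x.
      move=> nPEx; have [Qx|nQx] := pselect (Q x); [by left|right].
      by apply: restP => [[Px|//]|Ex]; apply: nPEx; [left|right].
    move=> [Qx [Px|[_]]|/Prest[nPQx nEx] [Px|//]]; first exact: (PQ0 x).
      by apply; right.
    by apply: nPQx; left.
  by apply: finite_componentsU => //; case: nQ.
have PE0 : P `&` E = set0.
  by apply/seteqP; split=> // x [Px [_ nPQx]]; apply: nPQx; left.
have K1G : K1 `<=` P `|` E.
  rewrite GE => x K1x; split; first by apply: KY; right.
  move=> /QV Vx; suff : (U `&` V) x by rewrite UV0.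
  by split=> //; apply: KU; right.
have [N1 [cN1 nN1 KN1 N1G]] := nice_between cK1 oG K1G.
apply: (@le_trans _ _ (mu_nice (P `|` E))%:E).
  by apply: le_trans (mu_cpt_le cN1 nN1 KN1) _; rewrite lee_fin; exact: mu_nice_le.
rewrite mu_niceU// EFinD; apply: leeD.
  by rewrite lee_fin; apply: mu_nice_le => // x /PU[[/interior_subset]].
(* [E] need not be compact, but it lies in a compact set that still misses [K]. *)
pose K2 := closure Y `\` P°.
have cK2 : compact K2.
  apply: subclosed_compact bY (@subDsetl _ _ _).
  rewrite /K2 setDE; apply: closedI; first exact: closed_closure.
  exact/open_closedC/open_interior.
apply: (@le_trans _ _ (mu_cpt K2)); last first.
  by apply: mu_opn_ge => // x [/YW Wx nPx]; split=> // /KP.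
apply: mu_cpt_ge => N2 cN2 nN2 K2N; rewrite lee_fin; apply: mu_nice_le => // x [Yx nPQx].
apply: interior_subset; apply: K2N; split; first exact: subset_closure.
by move=> /interior_subset Px; apply: nPQx; left.
Qed.

Lemma mu_opn_compactD W K : open W -> compact K -> K `<=` W ->
  mu_opn W = mu_cpt K + mu_opn (W `\` K).
Proof.
move=> oW cK KW; apply/eqP; rewrite eq_le; apply/andP; split.
  apply: mu_opn_le => K1 cK1 K1W; apply/lee_addgt0Pr => e e0.
  have [N [cN nN KN leN]] := mu_cpt_adherent cK e0.
  apply: le_trans (mu_cpt_le_nice_add oW cK KW cK1 K1W cN nN KN) _.
  by rewrite addeAC; apply: leeD leN _.
apply: adde_mu_opn_le => [|L cL LW]; first exact: mu_cpt_fin_num.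
rewrite -mu_cptU//; last by apply/seteqP; split=> // x [Kx /LW[_ /(_ Kx)]].
by apply: mu_opn_ge; [exact: compactU|rewrite subUset; split=> // x /LW[]].
Qed.

Definition mu A : \bar R := ereal_inf [set mu_opn U | U in [set U | open U /\ A `<=` U]].

Lemma mu_open U : open U -> mu U = mu_opn U.
Proof.
move=> oU; apply/eqP; rewrite eq_le; apply/andP; split.
  by apply: ereal_inf_lbound; exists U => //; split.
by apply: le_ereal_inf_tmp => _ [V [_ UV] <-]; exact: mu_opn_mono.
Qed.

Lemma mu_compact K : compact K -> mu K = mu_cpt K.
Proof.
move=> cK; apply/eqP; rewrite eq_le; apply/andP; split; last first.
  by apply: le_ereal_inf_tmp => _ [V [_ KV] <-]; exact: mu_opn_ge.
apply: mu_cpt_ge => N cN nN KN; apply: (@le_trans _ _ (mu_opn N°)).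
  by apply: ereal_inf_lbound; exists N° => //; split=> //; exact: open_interior.
apply: mu_opn_le => L _ LN; exact: mu_cpt_le.
Qed.

(** If the union is compact, embed it in a bounded open set [W]: removing [A `|` B]
from [W], or first [A] and then [B], leaves the same set, whose finite value
cancels. *)
Lemma mu_compact_open A B : compact A -> open B -> compact_or_open (A `|` B) ->
  A `&` B = set0 -> mu (A `|` B) = mu A + mu B.
Proof.
move=> cA oB cAB AB0; rewrite (mu_compact cA) (mu_open oB).
have disj x : A x -> B x -> False.
  by move=> Ax Bx; suff : (A `&` B) x by rewrite AB0.
case: cAB => [cAB|oAB]; last first.
  rewrite mu_open// (mu_opn_compactD oAB cA (@subsetUl _ A B)).
  congr (_ + mu_opn _); apply/seteqP; split=> x; first by move=> [[//|]].
  by move=> Bx; split; [right|move=> /disj; apply].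
rewrite mu_compact//; have [W [oW CW bW _]] := compact_bounded_open cAB openT (@subsetT _ _).
have := mu_opn_compactD oW cAB CW.
have AW : A `<=` W by apply: subset_trans CW; exact: subsetUl.
rewrite (mu_opn_compactD oW cA AW).
have -> : W `\` A = B `|` (W `\` (A `|` B)).
  apply/seteqP; split=> x.
    move=> [Wx nAx]; have [Bx|nBx] := pselect (B x); [by left|right].
    by split=> // -[].
  move=> [Bx|[Wx nABx]]; first by split; [apply: CW; right|move=> /disj; apply].
  by split=> // Ax; apply: nABx; left.
have oWC : open (W `\` (A `|` B)).
  by rewrite setDE; apply: openI => //; exact/closed_openC/(compact_is_closed cAB).
rewrite mu_opnU//; last by apply/seteqP; split=> // x [Bx [_]]; apply; right.
have xf : mu_opn (W `\` (A `|` B)) \is a fin_num.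
  by apply: mu_opn_fin_num; apply: bounded_sub bW; exact: subDsetl.
rewrite addeA => /(congr1 (fun z => z - mu_opn (W `\` (A `|` B)))).
by rewrite !addeK.
Qed.

Lemma topological_measure_mu : topological_measure mu.
Proof.
have mu_ge0 A : 0 <= mu A.
  by apply: le_ereal_inf_tmp => _ [U _ <-]; exact: mu_opn_ge0.
split=> //.
- exists set0; first by right; exact: open0.
  have := mu_cpt_fin_num (@compact0 X); rewrite -(mu_compact (@compact0 X)).
  by case: (mu set0).
- move=> A B [cA|oA] [cB|oB] AB AB0.
  + rewrite !mu_compact//; [exact: mu_cptU|exact: compactU].
  + exact: mu_compact_open.
  + rewrite setUC addeC; apply: mu_compact_open => //; first by rewrite setUC.
    by rewrite setIC.
  + rewrite !mu_open//; [exact: mu_opnU|exact: openU].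
- move=> U oU; rewrite mu_open//; congr ereal_sup.
  by apply/seteqP; split=> _ [K [cK KU] <-]; exists K => //; rewrite mu_compact.
- move=> F cF; rewrite {1}/mu; congr ereal_inf.
  by apply/seteqP; split=> _ [U [oU FU] <-]; exists U => //; rewrite mu_open.
Qed.

Lemma compact_finite_mu : compact_finite mu.
Proof.
move=> K cK; rewrite mu_compact// -ge0_fin_numE; first exact: mu_cpt_fin_num.
exact: mu_cpt_ge0.
Qed.

Lemma mu_cpt_bsolid K : compact K -> bsolid K -> mu_cpt K = (lam K)%:E.
Proof.
move=> cK sK; apply/eqP; rewrite eq_le; apply/andP; split; last first.
  apply: mu_cpt_ge => N cN nN KN; rewrite lee_fin; apply: bsolid_le_mu_nice => //.
  by apply: subset_trans KN _; exact: interior_subset.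
apply/lee_addgt0Pr => e e0; have [U [oU sU KU leU]] := lam_outer cK sK e0.
have [N [cN nN KN NU]] := nice_between cK oU KU.
apply: le_trans (mu_cpt_le cN nN KN) _; rewrite -EFinD lee_fin.
by apply: le_trans leU; exact: mu_nice_le_bsolid.
Qed.

Lemma mu_bsolid A : bsolid A -> mu A = (lam A)%:E.
Proof.
move=> sA; case: (sA) => _ [cA|[oA _]] _; first by rewrite mu_compact// mu_cpt_bsolid.
rewrite mu_open//; apply/eqP; rewrite eq_le; apply/andP; split.
  apply: mu_opn_le => K cK KA; have [N [cN nN KN NU]] := nice_between cK oA KA.
  by apply: le_trans (mu_cpt_le cN nN KN) _; rewrite lee_fin; exact: mu_nice_le_bsolid.
apply/lee_addgt0Pr => e e0; have [K [cK sK KA leK]] := lam_inner oA sA e0.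
apply: (@le_trans _ _ (mu_cpt K + e%:E)); first by rewrite mu_cpt_bsolid// -EFinD lee_fin.
by apply: leeD => //; exact: mu_opn_ge.
Qed.

Local Close Scope ereal_scope.

(** * Uniqueness *)

Section Uniqueness.
Local Open Scope ereal_scope.
Variable nu : set X -> \bar R.
Hypothesis nu_top : topological_measure nu.
Hypothesis nu_fin : compact_finite nu.
Hypothesis nu_lam : forall A, bsolid A -> nu A = (lam A)%:E.

Lemma nu_le_open A U : closed_or_open A -> open U -> A `<=` U -> nu A <= nu U.
Proof.
move=> [cA|oA] oU AU.
  by rewrite (topmeas_outer_regular nu_top cA); apply: ereal_inf_lbound; exists U.
rewrite (topmeas_inner_regular nu_top oA) (topmeas_inner_regular nu_top oU).
apply: ereal_sup_le => _ [K [cK KA] <-]; exists K => //; split=> //.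
exact: subset_trans AU.
Qed.

Lemma nu_le_compact K L : compact K -> compact L -> K `<=` L -> nu K <= nu L.
Proof.
move=> cK cL KL; rewrite (topmeas_outer_regular nu_top (compact_is_closed cL)).
apply: le_ereal_inf_tmp => _ [U [oU LU] <-]; apply: nu_le_open => //.
  by left; exact: compact_is_closed.
exact: subset_trans LU.
Qed.

(** [Phi] is the class of open or of compact sets: it ensures that all the partial
unions fall under the additivity axiom. *)
Lemma nu_bigcup (Phi : set X -> Prop) (f : set X -> R) F :
  Phi set0 -> (forall A B, Phi A -> Phi B -> Phi (A `|` B)) ->
  (forall A, Phi A -> compact_or_open A) -> finite_set F -> trivIset F id ->
  (forall A, F A -> Phi A /\ nu A = (f A)%:E) ->
  nu (\bigcup_(A in F) A) = (\sum_(A \in F) f A)%:E.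
Proof.
move=> Phi0 PhiU Phico Ff.
suff H : trivIset F id -> (forall A, F A -> Phi A /\ nu A = (f A)%:E) ->
    Phi (\bigcup_(A in F) A) /\ nu (\bigcup_(A in F) A) = (\sum_(A \in F) f A)%:E.
  by move=> tF HF; case: (H tF HF).
elim/finite_set_ind: F / Ff => [_ _|A F fF nFA IH tF HF].
  by rewrite bigcup_set0 fsbig_set0 nu_lam ?lam0//; exact: bsolid0.
have [PhiA nuA] : Phi A /\ nu A = (f A)%:E by apply: HF; left.
have [||PhiF nuF] := IH.
- by move=> B C FB FC; apply: tF; right.
- by move=> B FB; apply: HF; right.
rewrite bigcup_setU bigcup_set1; split; first exact: PhiU.
rewrite (topmeas_additive nu_top).
- rewrite nuA nuF -EFinD fsbigU0//; last by move=> B [-> /nFA].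
  by rewrite fsbig_set1.
- exact: Phico.
- exact: Phico.
- by apply/Phico/PhiU.
- apply/seteqP; split=> // x [Ax [B FB Bx]]; apply: nFA.
  by rewrite (tF A B)//; [left|right|exists x].
Qed.

Lemma nu_compact_cell P : compact P -> cell P -> nu P = (mu_cell P)%:E.
Proof.
move=> cP [P0 Pc fh sH hs].
have oh B : holes P B -> open B.
  by move=> [PB _]; apply: components_open PB; exact/closed_openC/(compact_is_closed cP).
have nuh : nu (\bigcup_(B in holes P) B) = (\sum_(B \in holes P) lam B)%:E.
  apply: (@nu_bigcup open) => //.
  - exact: open0.
  - exact: openU.
  - by right.
  - by move=> B C [PB _] [PC _]; exact: (components_eq PB PC).
  - by move=> B hB; split; [exact: oh|apply: nu_lam; exact: hs].
have := nu_lam sH; rewrite /hull (topmeas_additive nu_top).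
- rewrite nuh => /(congr1 (fun z => z - (\sum_(B \in holes P) lam B)%:E)).
  by rewrite addeK// -EFinB.
- by left.
- by right; exact: open_bigcup_set.
- by case: sH => _ [cH|[oH _]] _; [left|right].
- apply/seteqP; split=> // x [Px [B [PB _] Bx]].
  exact: (components_sub PB Bx).
Qed.

Lemma nu_nice N : compact N -> nice N -> nu N = (mu_nice N)%:E.
Proof.
move=> cN nN; have [_ fN _] := nN.
rewrite -{1}(components_cover N); apply: (@nu_bigcup compact) => //.
- exact: compact0.
- exact: compactU.
- by left.
- exact: components_trivIset.
- move=> P NP; have cP : compact P.
    apply: (subclosed_compact _ cN (components_sub NP)).
    by apply: components_closed NP; exact: compact_is_closed.
  by split=> //; apply: nu_compact_cell => //; exact: nice_cell NP.
Qed.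

(** Monotonicity squeezes the value at [K] between the nice compact neighbourhoods of
[K] and the open sets around [K], in each of which such a neighbourhood fits. *)
Lemma nu_compact K : compact K -> nu K = mu_cpt K.
Proof.
move=> cK; apply/eqP; rewrite eq_le; apply/andP; split.
  apply: mu_cpt_ge => N cN nN KN; rewrite -nu_nice//; apply: nu_le_compact => //.
  by apply: subset_trans KN _; exact: interior_subset.
rewrite (topmeas_outer_regular nu_top (compact_is_closed cK)).
apply: le_ereal_inf_tmp => _ [U [oU KU] <-].
have [N [cN nN KN NU]] := nice_between cK oU KU.
apply: le_trans (mu_cpt_le cN nN KN) _; rewrite -nu_nice//; apply: nu_le_open => //.
by left; exact: compact_is_closed.
Qed.

Lemma nu_open U : open U -> nu U = mu_opn U.
Proof.
move=> oU; rewrite (topmeas_inner_regular nu_top oU); congr ereal_sup.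
by apply/seteqP; split=> _ [K [cK KU] <-]; exists K => //; rewrite nu_compact.
Qed.

Lemma nu_unique A : closed_or_open A -> nu A = mu A.
Proof.
move=> [cA|oA]; last by rewrite nu_open// mu_open.
rewrite (topmeas_outer_regular nu_top cA); congr ereal_inf.
by apply/seteqP; split=> _ [U [oU AU] <-]; exists U => //; rewrite nu_open.
Qed.

End Uniqueness.

Lemma bsolid_extension : exists mu : set X -> \bar R,
  [/\ topological_measure mu, compact_finite mu,
      forall A, bsolid A -> mu A = (lam A)%:E
    & forall nu : set X -> \bar R, topological_measure nu -> compact_finite nu ->
        (forall A, bsolid A -> nu A = (lam A)%:E) ->
        forall A, closed_or_open A -> nu A = mu A].
Proof.
exists mu; split.
- exact: topological_measure_mu.
- exact: compact_finite_mu.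
- exact: mu_bsolid.
- by move=> nu *; exact: nu_unique.
Qed.

End Solid.

(** * From solid sets to the two kinds of spaces *)

Lemma bounded_solidE A : bounded_solid A <->
  (compact A \/ (open A /\ bounded_subset A)) /\ solid A.
Proof.
split; first by move=> [[cA sA]|[oA bA sA]]; split=> //; [left|right].
by move=> [[cA|[oA bA]] sA]; [left|right].
Qed.

Section SolidFunction.
Variables (R : realType) (lam : set X -> R).
Hypothesis lam_solid : solid_set_function lam.

Lemma lam_inner_approx U (e : R) : bounded_open_solid U -> 0 < e ->
  exists K, [/\ compact_solid K, K `<=` U & lam U <= lam K + e].
Proof.
move=> sU e0; have supE := solid_fun_inner_regular lam_solid sU.
have [|_ [K [KU sK] <-]] := @ub_ereal_sup_adherent _
    [set (lam K)%:E | K in [set K | K `<=` U /\ compact_solid K]] e e0.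
  by rewrite -supE.
rewrite -supE -EFinB lte_fin ltrBlDr => /ltW leU; exists K; split=> //.
Qed.

Lemma lam_outer_approx K (e : R) : compact_solid K -> 0 < e ->
  exists U, [/\ bounded_open_solid U, K `<=` U & lam U <= lam K + e].
Proof.
move=> sK e0; have infE := solid_fun_outer_regular lam_solid sK.
have [|_ [U [KU sU] <-]] := @lb_ereal_inf_adherent _
    [set (lam U)%:E | U in [set U | K `<=` U /\ bounded_open_solid U]] e e0.
  by rewrite -infE.
rewrite -infE -EFinD lte_fin => /ltW leU; exists U; split=> //.
Qed.

Lemma lam_compact_le K U : compact_solid K -> bounded_open_solid U -> K `<=` U ->
  lam K <= lam U.
Proof.
move=> sK sU KU; rewrite -lee_fin (solid_fun_inner_regular lam_solid sU).
by apply: ereal_sup_ubound; exists K.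
Qed.

Lemma lam_open_le V U : bounded_open_solid V -> bounded_open_solid U ->
  V `<=` U -> lam V <= lam U.
Proof.
move=> sV sU VU; apply/ler_addgt0Pr => e e0.
have [K [sK KV leV]] := lam_inner_approx sV e0; apply: le_trans leV _.
by rewrite lerD2r; apply: lam_compact_le => //; exact: subset_trans VU.
Qed.

Definition unique_extension := exists mu : set X -> \bar R,
  [/\ topological_measure mu, compact_finite mu, extends_solid lam mu
    & forall nu : set X -> \bar R,
        topological_measure nu -> compact_finite nu -> extends_solid lam nu ->
        forall A : set X, closed_or_open A -> nu A = mu A].

Lemma unique_extension_noncompact : ~ compact [set: X] -> unique_extension.
Proof.
move=> ncX; pose big : set (set X) := [set A | ~ bounded_subset A].
have bsE A : bsolid big A <-> bounded_solid A.
  rewrite bounded_solidE; split=> [[Ac At bA]|[At [Ac _ bA]]]; split=> //.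
    by split=> // _ x nAx; exact: bA (component_in nAx).
  by move=> D [x nAx <-]; exact: bA.
have csE A : compact A -> bsolid big A -> compact_solid A.
  by move=> cA /bsE/bounded_solidE[_ sA].
have osE A : open A -> bsolid big A -> bounded_open_solid A.
  by move=> oA sA; have /bounded_solidE[/bounded_type bA] := (bsE A).1 sA; split.
have [] := @bsolid_extension big _ _ _ R lam.
- by move=> A B AB nbA bB; apply: nbA; exact: bounded_sub bB.
- by move=> A; exact: contrapT.
- move=> A /contrapT bA bcA; apply: ncX; move: (boundedU bA bcA).
  by rewrite setUv /bounded_subset -(closure_id setT).1//; exact: closedT.
- move=> n D C cC sC sD tD DC; apply: (solid_fun_superadd lam_solid) => //.
  + exact: csE.
  + by move=> i; case: (sD i); exact: csE.
  + by move=> x [i _]; exact: DC.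
- move=> U e oU sU e0; have [K [[cK sK] KU leK]] := lam_inner_approx (osE _ oU sU) e0.
  by exists K; split=> //; apply/bsE; left.
- move=> K e cK sK e0; have [U [sU KU leU]] := lam_outer_approx (csE _ cK sK) e0.
  by exists U; split=> //; [case: sU|apply/bsE; right].
- move=> n D A sA sD tD AD; apply: (solid_fun_additive lam_solid) => //.
    exact/bsE.
  by move=> i; exact/bsE.
- move=> K U cK sK oU sU KU; apply: lam_compact_le => //; [exact: csE|exact: osE].
move=> mu [mu_top mu_fin mu_lam mu_uniq]; exists mu; split=> //.
  by move=> A /bsE; exact: mu_lam.
by move=> nu nu_top nu_fin nu_lam; apply: mu_uniq => // A /bsE; exact: nu_lam.
Qed.

(** A point [z] plays the role of infinity: [Z] is [[set z]], or [set0] if the space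
is empty. *)
Lemma unique_extension_compact (Z : set X) : (forall x : X, Z !=set0) ->
  (forall x y, Z x -> Z y -> x = y) -> compact [set: X] -> unique_extension.
Proof.
move=> Z0 Z1 cX; pose big : set (set X) := [set A | Z `<=` A].
have bounded A : bounded_subset A.
  by apply: subclosed_compact cX _ => //; exact: closed_closure.
have bigC A : ~ big A -> big (~` A).
  by move=> nbA z Zz Az; apply: nbA => y Zy; rewrite (Z1 y z).
have nbigC A : A !=set0 -> big A -> ~ big (~` A).
  by move=> [x _] bA bcA; have [z Zz] := Z0 x; exact: bcA Zz (bA _ Zz).
have big_full A : bsolid big A -> big A -> A = setT.
  move=> [_ _ sA] bA; apply/seteqP; split=> // x _; apply: contrapT => nAx.
  have [z Zz] := Z0 x; have := sA _ (component_in nAx) z Zz.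
  by move=> /connected_component_sub; apply; exact: bA.
have connected_bigC A : components (~` A) `<=` big -> connected (~` A).
  move=> sA; have [->|/set0P[x nAx]] := eqVneq (~` A) set0; first exact: connected0.
  suff -> : ~` A = connected_component (~` A) x by exact: component_connected.
  apply/seteqP; split=> [y nAy|]; last exact: connected_component_sub.
  have [z Zz] := Z0 x.
  have xz := sA _ (component_in nAx) z Zz; have yz := sA _ (component_in nAy) z Zz.
  by apply: connected_component_trans xz _; exact: connected_component_sym.
have bsS A : bsolid big A -> solid A.
  by move=> [Ac _ sA]; split=> // _; exact: connected_bigC.
have Sbs A : compact A \/ open A -> solid A -> ~ big A -> bsolid big A.
  move=> At [Ac /(_ cX) cAc _] nbA; split=> //.
    by case: At; [left|right].
  by move=> D /(connected_components_eq cAc)->; exact: bigC.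
have sT : bsolid big setT.
  by split=> //; [left|move=> D [x nTx]; case: nTx].
have csE A : compact A -> bsolid big A -> compact_solid A by move=> cA /bsS.
have osE A : open A -> bsolid big A -> bounded_open_solid A by move=> oA /bsS.
have bsE A : bsolid big A -> bounded_solid A.
  by move=> sA; apply/bounded_solidE; split; [case: sA|exact: bsS].
have big_mono A B : A `<=` B -> big A -> big B.
  by move=> AB bA; exact: subset_trans AB.
have s0 : bsolid big set0 by apply: bsolid0.
(* Outer regularity may produce open sets that contain [z]; inside such a set, the
   component around [K] of the complement of a connected compact set that joins
   [z] to the complement of [U] does not. *)
have shrink K U : compact K -> bsolid big K -> ~ big K -> K !=set0 -> open U ->
    K `<=` U -> exists V, [/\ open V, bsolid big V, K `<=` V & V `<=` U].
  move=> cK sK nbK [k Kk] oU KU; have [Kc _ sKC] := sK.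
  have oKC : open (~` K) by exact/closed_openC/(compact_is_closed cK).
  have [z Zz] := Z0 k; have nKz : (~` K) z by exact: bigC Zz.
  pose L := ~` U `|` Z.
  have ZE : Z = [set z] by apply/seteqP; split=> [y Zy|_ ->//]; exact: Z1.
  have cL : compact L.
    apply: compactU; last by rewrite ZE; exact: compact_set1.
    by apply: subclosed_compact cX _ => //; exact: open_closedC.
  have LK : L `<=` ~` K.
    by rewrite subUset; split; [exact: subsetC|exact: bigC].
  have [C [cC Cc C0 LC CK]] := compact_connected_between oKC
    (connected_bigC _ sKC) (ex_intro _ z nKz) cL LK.
  have nCk : (~` C) k by move=> /CK.
  have CV := component_in nCk; set V := connected_component _ _ in CV.
  have VC := components_sub CV.
  exists V; split.
  - by apply: components_open CV; exact/closed_openC/(compact_is_closed cC).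
  - apply: Sbs.
    + by right; apply: components_open CV; exact/closed_openC/(compact_is_closed cC).
    + split=> // [|_]; first exact: components_connected CV.
      apply: (connected_setC_component Cc C0 _ CV); left; exact: compact_is_closed.
    + by move=> bV; case: (VC z (bV _ Zz)); apply: LC; right.
  - by apply: connected_component_max => // x Kx /CK.
  - by move=> x Vx; apply: contrapT => nUx; apply: (VC _ Vx); apply: LC; left.
have [] := @bsolid_extension big _ _ _ R lam => //.
- move=> n D C cC sC sD tD DC; apply: (solid_fun_superadd lam_solid) => //.
  + exact: csE.
  + by move=> i; case: (sD i); exact: csE.
  + by move=> x [i _]; exact: DC.
- move=> U e oU sU e0; have [bU|nbU] := pselect (big U).
    by exists U; split=> //; [rewrite (big_full _ sU bU)|rewrite lerDl ltW].
  have [K [[cK sK] KU leK]] := lam_inner_approx (osE _ oU sU) e0.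
  exists K; split=> //; apply: Sbs => //; first by left.
  by move=> bK; apply: nbU; exact: big_mono bK.
- move=> K e cK sK e0; have [bK|nbK] := pselect (big K).
    exists K; split=> //; last by rewrite lerDl ltW.
    by rewrite (big_full _ sK bK); exact: openT.
  have [K0|/set0P K0] := eqVneq K set0.
    exists set0; rewrite K0; split=> //; first exact: open0.
    by rewrite lerDl ltW.
  have [U [sU KU leU]] := lam_outer_approx (csE _ cK sK) e0.
  have [oU _ _] := sU; have [V [oV sV KV VU]] := shrink _ _ cK sK nbK K0 oU KU.
  exists V; split=> //; apply: le_trans leU; apply: lam_open_le => //.
  exact: osE.
- move=> n D A sA sD tD AD; apply: (solid_fun_additive lam_solid) => //.
    exact: bsE.
  by move=> i; exact: bsE.
- move=> K U cK sK oU sU KU; apply: lam_compact_le => //; [exact: csE|exact: osE].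
move=> mu [mu_top mu_fin mu_lam mu_uniq]; exists mu; split=> //; last first.
  by move=> nu nu_top nu_fin nu_lam; apply: mu_uniq => // A /bsE; exact: nu_lam.
move=> A /bounded_solidE[At sA]; have At' : compact A \/ open A.
  by case: At => [|[]]; [left|right].
have [bA|nbA] := pselect (big A); last by apply: mu_lam; exact: Sbs.
have [AT|/eqP nAT] := eqVneq A setT; first by apply: mu_lam; rewrite AT.
have [a Aa] : A !=set0.
  apply/set0P/eqP => A0; apply: nAT; apply/seteqP; split=> // x _.
  by have [z Zz] := Z0 x; move: (bA z Zz); rewrite A0.
have cAt : compact (~` A) \/ open (~` A).
  case: At' => [cA|oA]; [right; exact/closed_openC/(compact_is_closed cA)|left].
  by apply: subclosed_compact cX _ => //; exact: open_closedC.
have [Ac /(_ cX) cAc _] := sA.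
have scA : bsolid big (~` A).
  apply: Sbs => //; first by split=> // _; rewrite setCK.
  by apply: nbigC => //; exists a.
(* A solid set that contains [z] and its complement partition the space. *)
have lamT : lam setT = lam A + lam (~` A).
  pose D (i : 'I_2) := if i == ord0 then A else ~` A.
  rewrite (@solid_fun_additive _ _ _ lam_solid 2%N D).
  - by rewrite big_ord_recl big_ord1.
  - exact: bsE.
  - by move=> i; rewrite /D; case: ifP => _; [apply/bounded_solidE|exact: bsE].
  - move=> [[|[|//]] i] [[|[|//]] j] _ _ [x []]; rewrite /D /= => Dx Ex;
      by [exact: val_inj|case: (Dx Ex)|case: (Ex Dx)].
  - apply/seteqP; split=> // x _; have [Ax|nAx] := pselect (A x).
      by exists ord0.
    by exists (lift ord0 ord0).
have cAfin : (mu A + mu (~` A))%E = (lam A + lam (~` A))%:E.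
  rewrite -lamT -(mu_lam _ sT) -(setUv A) (topmeas_additive mu_top)//.
  - by left; rewrite setUv.
  - by rewrite setICr.
move: cAfin; rewrite (mu_lam _ scA) EFinD => /(congr1 (fun x => x - (lam (~` A))%:E)%E).
by rewrite !addeK.
Qed.

End SolidFunction.
End LocallyNice.

(** * Existence and uniqueness *)

Theorem theorem10p7 (R : realType) (X : topologicalType)
    (X_hausdorff : hausdorff_space X)
    (X_locally_compact : locally_compact [set: X])
    (X_connected : connected [set: X])
    (X_locally_connected : locally_connected X)
    (lambda : set X -> R) (lambda_solid : solid_set_function lambda) :
  exists mu : set X -> \bar R,
    [/\ topological_measure mu, compact_finite mu, extends_solid lambda mu
      & forall nu : set X -> \bar R,
          topological_measure nu -> compact_finite nu ->
          extends_solid lambda nu ->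
          forall A : set X, closed_or_open A -> nu A = mu A].
Proof.
have [cX|ncX] := pselect (compact [set: X]); last exact: unique_extension_noncompact.
have [[z _]|nX] := pselect (exists z : X, True).
  apply: (@unique_extension_compact _ _ _ _ _ _ _ _ [set z]) => //.
    by move=> _; exists z.
  by move=> x y -> ->.
apply: (@unique_extension_compact _ _ _ _ _ _ _ _ set0) => //.
by move=> x; case: nX; exists x.
Qed.
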